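(* Let $\mathbf a:\mathbb R\to\mathcal H$ define a CMF dictionary in dimension $1$, i.e. $\langle\mathbf a(\theta),\mathbf a(\theta')\rangle=\varphi(|\theta-\theta'|^p)$ for a CMF $\varphi$ with $\varphi(0)=1$, $\lim_{x\to\infty}\varphi(x)=0$ and some $0<p\le1$. Then for every finite set $\mathcal S^\star\subset\mathbb R$ of pairwise distinct parameters, OMP achieves exact $\mathrm{card}(\mathcal S^\star)$-step recovery of $\mathcal S^\star$.
   Context: A function $\varphi:[0,\infty)\to\mathbb R$ is completely monotone (CMF) if it is infinitely differentiable on $(0,\infty)$, right-continuous at $0$, and $(-1)^n\varphi^{(n)}(x)\ge0$ for all $x>0$, $n\ge0$. $\mathcal H$ is a real Hilbert space. OMP with input $\mathbf y\in\mathcal H$: set $\mathbf r=\mathbf y$, $\widehat{\mathcal S}=\emptyset$, $t=0$; while $\mathbf r\ne 0$: $t\leftarrow t+1$; choose any $\widehat\theta_t\in\arg\max_{\theta}|\langle\mathbf a(\theta),\mathbf r\rangle|$; $\widehat{\mathcal S}\leftarrow\widehat{\mathcal S}\cup\{\widehat\theta_t\}$; compute $(\widehat c_1,\dots,\widehat c_t)\in\arg\min_{c\in\mathbb R^t}\|\mathbf y-\sum_{\ell=1}^t c_\ell\mathbf a(\widehat\theta_\ell)\|$; set $\mathbf r=\mathbf y-\sum_{\ell=1}^t\widehat c_\ell\mathbf a(\widehat\theta_\ell)$. Output $\widehat{\mathcal S}$. A reachable support is any output obtainable through some sequence of choices of maximizers. OMP achieves exact $k$-step recovery of $\mathcal S^\star=\{\theta^\star_\ell\}_{\ell=1}^k$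 if for every choice of nonzero reals $c_1,\dots,c_k$, every reachable support of OMP with input $\mathbf y=\sum_{\ell=1}^k c_\ell\mathbf a(\theta^\star_\ell)$ equals $\mathcal S^\star$. *)

(* Defs.v *)
From Stdlib Require Import Reals Lra List.
Import ListNotations.
Open Scope R_scope.

Record RHilbert := mkRHilbert {
  hV :> Type;
  hadd : hV -> hV -> hV;
  hscal : R -> hV -> hV;
  hzero : hV;
  hopp : hV -> hV;
  hinner : hV -> hV -> R;
  hadd_assoc : forall u v w, hadd u (hadd v w) = hadd (hadd u v) w;
  hadd_comm : forall u v, hadd u v = hadd v u;
  hadd_zero : forall u, hadd u hzero = u;
  hadd_opp : forall u, hadd u (hopp u) = hzero;
  hscal_one : forall u, hscal 1 u = u;
  hscal_assoc : forall a b u, hscal a (hscal b u) = hscal (a * b) u;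
  hscal_distr_v : forall a u v, hscal a (hadd u v) = hadd (hscal a u) (hscal a v);
  hscal_distr_s : forall a b u, hscal (a + b) u = hadd (hscal a u) (hscal b u);
  hinner_sym : forall u v, hinner u v = hinner v u;
  hinner_add_l : forall u v w, hinner (hadd u v) w = hinner u w + hinner v w;
  hinner_scal_l : forall a u v, hinner (hscal a u) v = a * hinner u v;
  hinner_pos : forall u, 0 <= hinner u u;
  hinner_def : forall u, hinner u u = 0 -> u = hzero;
  hcomplete : forall u : nat -> hV,
    (forall eps, eps > 0 -> exists N, forall m n, (m >= N)%nat -> (n >= N)%nat ->
        sqrt (hinner (hadd (u m) (hopp (u n))) (hadd (u m) (hopp (u n)))) < eps) ->
    exists l, forall eps, eps > 0 -> exists N, forall n, (n >= N)%nat ->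
        sqrt (hinner (hadd (u n) (hopp l)) (hadd (u n) (hopp l))) < eps
}.

Arguments hadd {_}. Arguments hscal {_}. Arguments hzero {_}.
Arguments hopp {_}. Arguments hinner {_}.

Definition hsub {H : RHilbert} (u v : H) : H := hadd u (hopp v).
Definition hnorm {H : RHilbert} (u : H) : R := sqrt (hinner u u).

Fixpoint lincomb {H : RHilbert} (a : R -> H) (cs ths : list R) : H :=
  match cs, ths with
  | c :: cs', th :: ths' => hadd (hscal c (a th)) (lincomb a cs' ths')
  | _, _ => hzero
  end.

Definition CMF (phi : R -> R) : Prop :=
  exists D : nat -> R -> R,
    (forall x, 0 < x -> D 0%nat x = phi x) /\
    (forall n x, 0 < x -> derivable_pt_lim (D n) x (D (S n) x)) /\
    (forall eps, eps > 0 -> exists delta, delta > 0 /\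
        forall x, 0 <= x < delta -> Rabs (phi x - phi 0) < eps) /\
    (forall n x, 0 < x -> 0 <= (-1) ^ n * D n x).

(** x^p for x >= 0 and real p > 0, with 0^p = 0. *)
Definition rpow (x p : R) : R :=
  if Req_EM_T x 0 then 0 else Rpower x p.

Definition CMF_dictionary {H : RHilbert} (a : R -> H) : Prop :=
  exists (phi : R -> R) (p : R),
    CMF phi /\ phi 0 = 1 /\
    (forall eps, eps > 0 -> exists M, forall x, x > M -> Rabs (phi x) < eps) /\
    0 < p <= 1 /\
    forall th th', hinner (a th) (a th') = phi (rpow (Rabs (th - th')) p).

Definition ls_residual {H : RHilbert} (a : R -> H) (y : H) (ths : list R) (r : H)
  : Prop :=
  exists cs : list R, length cs = length ths /\
    r = hsub y (lincomb a cs ths) /\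
    forall cs' : list R, length cs' = length ths ->
      hnorm (hsub y (lincomb a cs ths)) <= hnorm (hsub y (lincomb a cs' ths)).

Definition is_argmax_corr {H : RHilbert} (a : R -> H) (r : H) (th : R) : Prop :=
  forall th', Rabs (hinner (a th') r) <= Rabs (hinner (a th) r).

Inductive omp_trace {H : RHilbert} (a : R -> H) (y : H) : list R -> H -> Prop :=
| omp_start : omp_trace a y [] y
| omp_step : forall sel r th r',
    omp_trace a y sel r -> r <> hzero ->
    is_argmax_corr a r th ->
    ls_residual a y (sel ++ [th]) r' ->
    omp_trace a y (sel ++ [th]) r'.

Definition reachable_support {H : RHilbert} (a : R -> H) (y : H) (S : R -> Prop)
  : Prop :=
  exists sel, omp_trace a y sel hzero /\ forall th, S th <-> In th sel.

Definition exact_recovery {H : RHilbert} (a : R -> H) (Sstar : list R) : Prop :=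
  forall cs : list R, length cs = length Sstar -> Forall (fun c => c <> 0) cs ->
  forall S, reachable_support a (lincomb a cs Sstar) S ->
    forall th, S th <-> In th Sstar.

(* Main.v *)
From Stdlib Require Import Reals List Lra Lia ZArith Psatz Classical.
Require Import Defs.
Import ListNotations.
Open Scope R_scope.

(* The kernel is [g(|s - t|)] with [g(t) = phi(t^p)] again completely monotone. It satisfies a
   maximum principle: a combination [f] of its translates that is at most [M >= 0] at its nodes
   is at most [M] everywhere. For a finite mixture of [s^|i - j|] on the integers, the kernel is
   [h(P) = sum_n h_n P^n] with [P] the simple random walk and [h_n] log-convex, so by Kaluza's
   theorem [1 / h(x) = (1 - sum_k g_k x^(k+1)) / h_0] with [g_k >= 0] and [sum g_k < 1]: off its
   nodes, [f] is a sub-average of its own values. Hausdorff's moment approximation passes to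
   completely monotone sequences, and rounding to a fine grid passes to the line.
   Strict convexity of [g] makes the principle strict off the nodes, hence the correlation with
   a nonzero combination of atoms is maximal in modulus only at nodes, and OMP never leaves the
   support. The principle also makes distinct atoms linearly independent, so a zero residual
   forces the whole support to have been selected. *)

(** * Finite sums over lists *)

Definition Rsum {A : Type} (F : A -> R) (l : list A) : R :=
  fold_right (fun x s => F x + s) 0 l.

Lemma Rsum_cons {A : Type} (F : A -> R) (x : A) (l : list A) :
  Rsum F (x :: l) = F x + Rsum F l.
Proof. reflexivity. Qed.

Lemma Rsum_ext {A : Type} (F G : A -> R) (l : list A) :
  (forall x, In x l -> F x = G x) -> Rsum F l = Rsum G l.
Proof.
  induction l as [|x l IH]; intros h; [reflexivity|].
  rewrite !Rsum_cons, h, IH; simpl; auto.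
  intros y hy; apply h; simpl; auto.
Qed.

Lemma Rsum_plus {A : Type} (F G : A -> R) (l : list A) :
  Rsum (fun x => F x + G x) l = Rsum F l + Rsum G l.
Proof. induction l as [|x l IH]; [simpl; lra|]. rewrite !Rsum_cons, IH; lra. Qed.

Lemma Rsum_scal {A : Type} (a : R) (F : A -> R) (l : list A) :
  Rsum (fun x => a * F x) l = a * Rsum F l.
Proof. induction l as [|x l IH]; [simpl; lra|]. rewrite !Rsum_cons, IH; lra. Qed.

Lemma Rsum_app {A : Type} (F : A -> R) (l l' : list A) :
  Rsum F (l ++ l') = Rsum F l + Rsum F l'.
Proof. induction l as [|x l IH]; [simpl; lra|]. simpl app; rewrite !Rsum_cons, IH; lra. Qed.

Lemma Rsum_map {A B : Type} (g : A -> B) (F : B -> R) (l : list A) :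
  Rsum F (map g l) = Rsum (fun x => F (g x)) l.
Proof. induction l as [|x l IH]; [reflexivity|]. simpl map; rewrite !Rsum_cons, IH; lra. Qed.

Lemma Rsum_le {A : Type} (F G : A -> R) (l : list A) :
  (forall x, In x l -> F x <= G x) -> Rsum F l <= Rsum G l.
Proof.
  induction l as [|x l IH]; intros h; [simpl; lra|].
  rewrite !Rsum_cons.
  apply Rplus_le_compat; [apply h; simpl; auto|].
  apply IH; intros y hy; apply h; simpl; auto.
Qed.

Lemma Rsum_zero {A : Type} (l : list A) : Rsum (fun _ => 0) l = 0.
Proof. induction l as [|x l IH]; [reflexivity|]. rewrite Rsum_cons, IH; lra. Qed.

Lemma Rsum_nonneg {A : Type} (F : A -> R) (l : list A) :
  (forall x, In x l -> 0 <= F x) -> 0 <= Rsum F l.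
Proof. intros h; rewrite <- (Rsum_zero l); apply Rsum_le, h. Qed.

Lemma Rabs_Rsum_le {A : Type} (F : A -> R) (l : list A) :
  Rabs (Rsum F l) <= Rsum (fun x => Rabs (F x)) l.
Proof.
  induction l as [|x l IH]; [simpl; rewrite Rabs_R0; lra|].
  rewrite !Rsum_cons.
  eapply Rle_trans; [apply Rabs_triang|lra].
Qed.

Lemma Rsum_swap {A B : Type} (F : A -> B -> R) (l : list A) (l' : list B) :
  Rsum (fun x => Rsum (F x) l') l = Rsum (fun y => Rsum (fun x => F x y) l) l'.
Proof.
  induction l as [|x l IH].
  - symmetry; apply (Rsum_zero l').
  - rewrite Rsum_cons, IH, <- Rsum_plus. reflexivity.
Qed.

Lemma Rsum_nonneg_zero {A : Type} (F : A -> R) (l : list A) :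
  (forall x, In x l -> 0 <= F x) -> Rsum F l = 0 -> forall x, In x l -> F x = 0.
Proof.
  induction l as [|y l IH]; intros h e x hx; [destruct hx|].
  rewrite Rsum_cons in e.
  assert (h1 : 0 <= F y) by (apply h; simpl; auto).
  assert (h2 : forall z, In z l -> 0 <= F z) by (intros; apply h; simpl; auto).
  pose proof (Rsum_nonneg _ _ h2).
  destruct hx as [<-|hx]; [lra|].
  apply IH; auto; lra.
Qed.

(** * The maximum principle for kernels, its limits and pullbacks *)

Definition comb {T : Type} (k : T -> T -> R) (l : list (R * T)) (t : T) : R :=
  Rsum (fun q => fst q * k t (snd q)) l.

Definition max_principle {T : Type} (k : T -> T -> R) : Prop :=
  forall (l : list (R * T)) (M : R) (t : T), 0 <= M ->
    (forall q, In q l -> comb k l (snd q) <= M) -> comb k l t <= M.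

Lemma comb_le {T : Type} (k : T -> T -> R) (l : list (R * T)) (e : R) (t : T) :
  (forall q, In q l -> Rabs (k t (snd q)) <= e) ->
  comb k l t <= e * Rsum (fun q => Rabs (fst q)) l.
Proof.
  intros h. unfold comb. rewrite <- Rsum_scal. apply Rsum_le.
  intros q hq. specialize (h q hq).
  eapply Rle_trans; [apply Rle_abs|]. rewrite Rabs_mult.
  pose proof (Rabs_pos (fst q)). nra.
Qed.

Lemma comb_minus {T : Type} (k k' : T -> T -> R) (l : list (R * T)) (t : T) :
  comb (fun s t => k s t - k' s t) l t = comb k l t - comb k' l t.
Proof.
  unfold comb. 
  replace (Rsum (fun q => fst q * k t (snd q)) l - Rsum (fun q => fst q * k' t (snd q)) l)
   with (Rsum (fun q => fst q * k t (snd q)) l + (-1) * Rsum (fun q => fst q * k' t (snd q)) l) by ring.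
  rewrite <- Rsum_scal, <- Rsum_plus. apply Rsum_ext; intros; ring.
Qed.

(** Only the nodes and [t] matter, so closeness on finite sets is enough: passing to [k'] and back
    costs, each way, [e] times the total mass of the coefficients. *)
Lemma max_principle_limit {T : Type} (k : T -> T -> R) :
  (forall (pts : list T) (e : R), 0 < e -> exists k', max_principle k' /\
     forall s t, In s pts -> In t pts -> Rabs (k s t - k' s t) <= e) ->
  max_principle k.
Proof.
  intros happ l M t hM hl.
  destruct (Rle_or_lt (comb k l t) M) as [|hlt]; [assumption|exfalso].
  set (C := Rsum (fun q => Rabs (fst q)) l).
  assert (hC : 0 <= C) by (apply Rsum_nonneg; intros; apply Rabs_pos).
  (* The two passages cost at most [2 * e * C], less than the supposed violation
     [3 * (e * (C + 1))]. *)
  set (e := (comb k l t - M) / (3 * (C + 1))).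
  assert (he : 0 < e) by (apply Rdiv_lt_0_compat; lra).
  assert (heC : 3 * (e * (C + 1)) = comb k l t - M) by (unfold e; field; lra).
  destruct (happ (t :: map snd l) e he) as [k' [hk' hkk]].
  assert (close : forall s, In s (t :: map snd l) ->
     comb k l s <= comb k' l s + e * C /\ comb k' l s <= comb k l s + e * C).
  { intros s hs.
    assert (h1 : comb (fun s t => k s t - k' s t) l s <= e * C).
    { apply comb_le. intros q hq. apply hkk; auto. right. apply in_map, hq. }
    assert (h2 : comb (fun s t => k' s t - k s t) l s <= e * C).
    { apply comb_le. intros q hq. rewrite Rabs_minus_sym. apply hkk; auto.
      right. apply in_map, hq. }
    rewrite comb_minus in h1, h2. lra. }
  assert (h := hk' l (M + e * C) t).
  assert (0 <= e * C) by (apply Rmult_le_pos; lra).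
  destruct (close t (or_introl eq_refl)) as [h1 _].
  assert (comb k' l t <= M + e * C).
  { apply h; [lra|]. intros q hq.
    destruct (close (snd q)) as [_ h2]; [right; apply in_map, hq|].
    specialize (hl q hq). lra. }
  lra.
Qed.

(** The map [g] may identify points, since pushing nodes forward only produces repeated nodes;
    rounding to a grid is such a map. *)
Lemma max_principle_pullback {T U : Type} (g : U -> T) (k : T -> T -> R) :
  max_principle k -> max_principle (fun s t => k (g s) (g t)).
Proof.
  intros hk l M t hM hl.
  assert (e : forall s, comb (fun s t => k (g s) (g t)) l s
      = comb k (map (fun q => (fst q, g (snd q))) l) (g s)).
  { intros s. unfold comb. rewrite Rsum_map. reflexivity. }
  rewrite e. apply hk; [assumption|].
  intros q hq. apply in_map_iff in hq. destruct hq as [q' [<- hq']].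
  simpl. rewrite <- e. apply hl, hq'.
Qed.

(** * Mixtures of geometric kernels on the integer lattice *)

(* For positive weights [p] and nodes [b], [renewal l] are the coefficients [g_k] of
   [1 - h_0 / h(x) = sum_k g_k x^(k+1)] where [h(x) = sum_n (sum p b^n) x^n], and
   [remainder l n b = b^n - sum_(k < n) g_k b^(n-1-k)]. *)
Fixpoint remainder (l : list (R * R)) (n : nat) (b : R) : R :=
  match n with
  | O => 1
  | S n => b * remainder l n b
           - Rsum (fun q => fst q * (snd q * remainder l n (snd q))) l / Rsum fst l
  end.

Definition renewal (l : list (R * R)) (n : nat) : R :=
  Rsum (fun q => fst q * (snd q * remainder l n (snd q))) l / Rsum fst l.

Lemma remainder_S (l : list (R * R)) (n : nat) (b : R) :
  remainder l (S n) b = b * remainder l n b - renewal l n.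
Proof. reflexivity. Qed.

(** [renewal l n] is the weighted mean of [b * remainder l n b], so subtracting it centres the next
    remainder. *)
Lemma remainder_orthogonal (l : list (R * R)) (n : nat) :
  Rsum fst l <> 0 ->
  Rsum (fun q => fst q * remainder l (S n) (snd q)) l = 0.
Proof.
  intros h.
  rewrite (Rsum_ext _ (fun q => fst q * (snd q * remainder l n (snd q))
                               + (- renewal l n) * fst q)).
  - rewrite Rsum_plus, Rsum_scal. unfold renewal. field. assumption.
  - intros q _. rewrite remainder_S. ring.
Qed.

(** As the node grows, [z] never passes from positive to negative, and [t] is its crossing point. A
    new node with negative value can only push the crossing up, one with positive value only
    down. *)
Lemma sign_threshold (z : R -> R) (l : list (R * R)) :
  (forall q q', In q l -> In q' l -> snd q <= snd q' -> 0 < z (snd q) -> 0 <= z (snd q')) ->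
  exists t, forall q, In q l -> 0 <= (snd q - t) * z (snd q).
Proof.
  induction l as [|b l IH]; intros h.
  - exists 0. intros q [].
  - destruct IH as [t ht].
    { intros q q' hq hq'. apply h; simpl; auto. }
    destruct (Rtotal_order (z (snd b)) 0) as [hb|[hb|hb]].
    + exists (Rmax t (snd b)). intros q [<-|hq].
      * pose proof (Rmax_r t (snd b)). nra.
      * specialize (ht q hq).
        assert (hq0 := h q b (or_intror hq) (or_introl eq_refl)).
        unfold Rmax. destruct (Rle_dec t (snd b)); [|exact ht].
        destruct (Rle_or_lt (snd q) (snd b)); [|nra].
        destruct (Rle_or_lt (z (snd q)) 0); nra.
    + exists t. intros q [<-|hq]; [rewrite hb; lra|auto].
    + exists (Rmin t (snd b)). intros q [<-|hq].
      * pose proof (Rmin_r t (snd b)). nra.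
      * specialize (ht q hq).
        assert (hq0 := h b q (or_introl eq_refl) (or_intror hq)).
        unfold Rmin. destruct (Rle_dec t (snd b)); [exact ht|].
        destruct (Rle_or_lt (snd q) (snd b)) as [hle|hlt].
        -- destruct (Rle_or_lt (z (snd q)) 0); nra.
        -- specialize (hq0 (Rlt_le _ _ hlt) hb). nra.
Qed.

Definition admissible (l : list (R * R)) (rho : R) : Prop :=
  0 < Rsum fst l /\ 0 < rho < 1 /\
  forall q, In q l -> 0 <= fst q /\ 0 < snd q <= rho.

(** Kaluza's argument. As [remainder l n x / x ^ n] is nondecreasing, the remainder changes sign at
    some [t]; for [n > 0] orthogonality lets [b - t] replace the factor [b], and then every term is
    nonnegative. Monotonicity is a hypothesis because its own induction relies on these signs. *)
Lemma renewal_nonneg_aux (l : list (R * R)) (rho : R) (n : nat) :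
  admissible l rho ->
  (forall x y, 0 < x <= y -> remainder l n x * y ^ n <= remainder l n y * x ^ n) ->
  0 <= renewal l n.
Proof.
  intros [hs [hr hl]] hmono.
  apply Rmult_le_pos; [|left; apply Rinv_0_lt_compat, hs].
  destruct n as [|n].
  { apply Rsum_nonneg. intros q hq. destruct (hl q hq). simpl. nra. }
  destruct (sign_threshold (remainder l (S n)) l) as [t ht].
  { intros q q' hq hq' hle hz.
    destruct (hl q hq), (hl q' hq').
    specialize (hmono (snd q) (snd q') ltac:(lra)).
    assert (0 < snd q ^ S n) by (apply pow_lt; lra).
    assert (0 < snd q' ^ S n) by (apply pow_lt; lra).
    nra. }
  rewrite (Rsum_ext _ (fun q => fst q * ((snd q - t) * remainder l (S n) (snd q))
                         + t * (fst q * remainder l (S n) (snd q))))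
    by (intros; ring).
  rewrite Rsum_plus, Rsum_scal, remainder_orthogonal by lra.
  rewrite Rmult_0_r, Rplus_0_r.
  apply Rsum_nonneg. intros q hq. specialize (ht q hq). destruct (hl q hq).
  apply Rmult_le_pos; lra.
Qed.

(** Here [remainder l n x / x ^ n = 1 - sum_(k < n) g_k x^(-k-1)], nondecreasing once the earlier
    [g_k] are nonnegative; signs and monotonicity advance together. *)
Lemma remainder_ratio (l : list (R * R)) (rho : R) (n : nat) :
  admissible l rho ->
  forall x y, 0 < x <= y -> remainder l n x * y ^ n <= remainder l n y * x ^ n.
Proof.
  intros hl. induction n as [|n IH]; intros x y hxy; [simpl; lra|].
  assert (hg := renewal_nonneg_aux _ _ _ hl IH).
  specialize (IH x y hxy).
  assert (hp := pow_incr x y (S n) ltac:(lra)).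
  rewrite !remainder_S. simpl in *.
  assert (0 < x * y) by (apply Rmult_lt_0_compat; lra).
  nra.
Qed.

Lemma renewal_nonneg (l : list (R * R)) (rho : R) (n : nat) :
  admissible l rho -> 0 <= renewal l n.
Proof. intros hl. eapply renewal_nonneg_aux; eauto using remainder_ratio. Qed.

Lemma remainder_upper (l : list (R * R)) (rho : R) (n : nat) (x : R) :
  admissible l rho -> 0 < x <= rho -> remainder l n x <= rho ^ n.
Proof.
  intros hl hx. induction n as [|n IH]; [simpl; lra|].
  rewrite remainder_S. pose proof (renewal_nonneg l rho n hl).
  assert (0 < rho ^ n) by (apply pow_lt; lra). simpl. nra.
Qed.

Lemma renewal_upper (l : list (R * R)) (rho : R) (n : nat) :
  admissible l rho -> renewal l n <= rho ^ S n.
Proof.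
  intros hl. assert (hl' := hl). destruct hl' as [hs [hr hq]].
  apply Rmult_le_reg_r with (Rsum fst l); [assumption|].
  unfold renewal, Rdiv. rewrite Rmult_assoc, Rinv_l, Rmult_1_r by lra.
  rewrite <- Rsum_scal. apply Rsum_le. intros q h. destruct (hq q h).
  pose proof (remainder_upper l rho n (snd q) hl ltac:(lra)).
  assert (0 < rho ^ n) by (apply pow_lt; lra).
  rewrite Rmult_comm. apply Rmult_le_compat_r; [lra|]. simpl. nra.
Qed.

(** Each step multiplies by at most [rho] and subtracts at most [rho ^ S n], whence the linear
    factor. With the upper bound, the remainders tend to 0 uniformly over the nodes. *)
Lemma remainder_lower (l : list (R * R)) (rho : R) (n : nat) (x : R) :
  admissible l rho -> 0 < x <= rho -> - (INR n * rho ^ n) <= remainder l n x.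
Proof.
  intros hl hx. induction n as [|n IH]; [simpl; lra|].
  rewrite remainder_S, S_INR. pose proof (renewal_upper l rho n hl) as hu.
  assert (0 < rho ^ n) by (apply pow_lt; lra). pose proof (pos_INR n).
  simpl in *.
  assert (0 <= INR n * rho ^ n) by (apply Rmult_le_pos; lra).
  destruct (Rle_or_lt 0 (remainder l n x)); nra.
Qed.

(** On the nodes and [rho], the ratio [remainder l n x / x ^ n] is largest at [rho]. Were it
    negative there, it would be negative at every node, against the vanishing weighted mean. *)
Lemma remainder_top_nonneg (l : list (R * R)) (rho : R) (n : nat) :
  admissible l rho -> 0 <= remainder l n rho.
Proof.
  intros hl. assert (hl' := hl). destruct hl' as [hs [hr hq]].
  destruct n as [|n]; [simpl; lra|].
  destruct (Rle_or_lt 0 (remainder l (S n) rho)) as [|hlt]; [assumption|exfalso].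
  assert (hneg : forall q, In q l -> remainder l (S n) (snd q) < 0).
  { intros q h. destruct (hq q h).
    pose proof (remainder_ratio l rho (S n) hl (snd q) rho ltac:(lra)).
    assert (0 < snd q ^ S n) by (apply pow_lt; lra).
    assert (0 < rho ^ S n) by (apply pow_lt; lra). nra. }
  assert (hz := remainder_orthogonal l n ltac:(lra)).
  assert (hz' : Rsum (fun q => - (fst q * remainder l (S n) (snd q))) l = 0).
  { rewrite (Rsum_ext _ (fun q => (-1) * (fst q * remainder l (S n) (snd q))))
      by (intros; ring). rewrite Rsum_scal, hz. ring. }
  assert (h0 : forall q, In q l -> fst q = 0).
  { intros q h.
    assert (hp : forall q', In q' l -> 0 <= - (fst q' * remainder l (S n) (snd q'))).
    { intros q' h'. destruct (hq q' h'). specialize (hneg q' h'). nra. }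
    assert (e := Rsum_nonneg_zero _ l hp hz' q h).
    specialize (hneg q h). cbv beta in e. nra. }
  rewrite (Rsum_ext _ (fun _ => 0)), Rsum_zero in hs by auto. lra.
Qed.

Lemma renewal_sum (l : list (R * R)) (rho : R) (n : nat) :
  admissible l rho -> Rsum (renewal l) (seq 0 n) <= rho.
Proof.
  intros hl. assert (hl' := hl). destruct hl' as [_ [hr _]].
  (* Exactly, the left side is [rho ^ n * (rho - sum_(k < n) g_k rho^(-k))]. Dropping the factors
     [rho^(-k) >= 1] gives the inequality, and nonnegativity of the left side then bounds the
     sum. *)
  assert (h : rho * remainder l n rho <= rho ^ n * (rho - Rsum (renewal l) (seq 0 n))).
  { induction n as [|n IH]; [simpl; lra|].
    rewrite remainder_S, seq_S, Rsum_app, Rsum_cons. simpl Rsum at 2. simpl Nat.add.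
    pose proof (renewal_nonneg l rho n hl).
    assert (0 < rho ^ n <= 1).
    { split; [apply pow_lt; lra|]. rewrite <- (pow1 n). apply pow_incr; lra. }
    assert (rho ^ n * renewal l n <= 1 * renewal l n) by (apply Rmult_le_compat_r; lra).
    simpl pow. nra. }
  pose proof (remainder_top_nonneg l rho n hl).
  assert (0 < rho ^ n) by (apply pow_lt; lra). nra.
Qed.

Lemma linear_geometric_small (rho C e : R) :
  0 < rho < 1 -> 0 <= C -> 0 < e -> exists n, C * (INR n + 1) * rho ^ n <= e.
Proof.
  intros hr hC he.
  set (sg := (1 + rho) / 2). set (h := sg / rho - 1).
  assert (hsg : rho < sg < 1) by (unfold sg; lra).
  assert (hh : 0 < h).
  { unfold h. replace (sg / rho - 1) with ((sg - rho) / rho) by (field; lra).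
    apply Rdiv_lt_0_compat; lra. }
  assert (hsr : sg = rho * (1 + h)) by (unfold h; field; lra).
  set (K := C * (1 + / h) + 1).
  assert (hih : 0 < / h) by (apply Rinv_0_lt_compat, hh).
  assert (hK : 0 < K) by (unfold K; nra).
  destruct (pow_lt_1_zero sg ltac:(rewrite Rabs_right; lra) (e / K)) as [n hn].
  { apply Rdiv_lt_0_compat; assumption. }
  exists n. specialize (hn n (le_n n)).
  assert (hp : 0 < rho ^ n) by (apply pow_lt; lra).
  (* Bernoulli's inequality: [(1 + h) ^ n] absorbs the linear factor, and [rho * (1 + h) = sg] is
     still below 1. *)
  assert (hb := poly n h hh).
  assert (hs : sg ^ n = rho ^ n * (1 + h) ^ n) by (rewrite hsr; apply Rpow_mult_distr).
  assert (hN : INR n + 1 <= (1 + / h) * (1 + h) ^ n).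
  { apply Rle_trans with ((1 + / h) * (1 + INR n * h)).
    - replace ((1 + / h) * (1 + INR n * h)) with (INR n + 1 + (INR n * h + / h)) by (field; lra).
      pose proof (pos_INR n). nra.
    - apply Rmult_le_compat_l; lra. }
  apply Rle_trans with (C * ((1 + / h) * (1 + h) ^ n) * rho ^ n).
  { apply Rmult_le_compat_r; [lra|]. apply Rmult_le_compat_l; lra. }
  replace (C * ((1 + / h) * (1 + h) ^ n) * rho ^ n) with (C * (1 + / h) * sg ^ n)
    by (rewrite hs; ring).
  rewrite Rabs_right in hn by (apply Rle_ge, pow_le; lra).
  assert (0 < sg ^ n) by (apply pow_lt; lra).
  apply Rle_trans with (K * sg ^ n); [unfold K; nra|].
  apply Rle_trans with (K * (e / K)); [apply Rmult_le_compat_l; lra|].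
  right. field. lra.
Qed.

(** * Contraction for mixtures of random-walk resolvents *)

Definition neighbour_mean (v : Z -> R) (i : Z) : R := (v (i - 1)%Z + v (i + 1)%Z) / 2.

Definition mix {A : Type} (l : list (R * A)) (z : A -> R) (u : A -> Z -> R) (i : Z) : R :=
  Rsum (fun q => fst q * (z (snd q) * u (snd q) i)) l.

Lemma mix_neighbour_mean {A : Type} (l : list (R * A)) (z : A -> R) (u : A -> Z -> R) (i : Z) :
  Rsum (fun q => fst q * (z (snd q) * neighbour_mean (u (snd q)) i)) l
    = neighbour_mean (mix l z u) i.
Proof.
  unfold neighbour_mean, mix.
  replace ((Rsum (fun q => fst q * (z (snd q) * u (snd q) (i - 1)%Z)) l +
     Rsum (fun q => fst q * (z (snd q) * u (snd q) (i + 1)%Z)) l) / 2)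
   with (/ 2 * (Rsum (fun q => fst q * (z (snd q) * u (snd q) (i - 1)%Z)) l +
     Rsum (fun q => fst q * (z (snd q) * u (snd q) (i + 1)%Z)) l)) by field.
  rewrite <- Rsum_plus, <- Rsum_scal. apply Rsum_ext; intros; field.
Qed.

(* With [V_n = sum_s w be remainder_n(be) u_s] one has [mix = h_0 c + P V_0] and
   [V_n = g_n mix + P V_(n+1)] for [P] the neighbour mean, [g_n] the renewal coefficients;
   they are nonnegative with sum at most [rho], and [V_n] tends to 0. *)
Lemma resolvent_mixture_contraction {A : Type} (l : list (R * A)) (al be : A -> R)
    (u : A -> Z -> R) (c : Z -> R) (rho F U : R) :
  (forall q, In q l -> 0 <= fst q) ->
  (forall q i, In q l -> u (snd q) i = al (snd q) * c i + be (snd q) * neighbour_mean (u (snd q)) i) ->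
  (forall q i, In q l -> Rabs (u (snd q) i) <= U) ->
  admissible (map (fun q => (fst q * al (snd q), be (snd q))) l) rho ->
  0 <= F -> (forall i, mix l (fun _ => 1) u i <= F) ->
  forall i, c i = 0 -> mix l (fun _ => 1) u i <= rho * F.
Proof.
  intros hw hu hU hl hF0 hF i hci.
  set (pl := map (fun q => (fst q * al (snd q), be (snd q))) l) in *.
  set (f := mix l (fun _ => 1) u) in *.
  set (V := fun n => mix l (fun s => be s * remainder pl n (be s)) u).
  assert (hl' := hl). destruct hl' as [hs [hr hq]].
  assert (hfV : f i = neighbour_mean (V 0%nat) i).
  { unfold V. rewrite <- mix_neighbour_mean. unfold f, mix.
    apply Rsum_ext. intros q h. rewrite (hu q i h), hci. simpl. ring. }
  (* Split [be * remainder n] into [renewal n] plus [remainder (n + 1)] and expand [u] in the second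
     piece only: the source [c j] is then multiplied by the orthogonal sum and drops out. *)
  assert (hV : forall n j, V n j = renewal pl n * f j + neighbour_mean (V (S n)) j).
  { intros n j. unfold V. rewrite <- mix_neighbour_mean.
    unfold f, mix. rewrite <- Rsum_scal, <- Rsum_plus.
    assert (ho := remainder_orthogonal pl n ltac:(lra)).
    unfold pl in ho. rewrite Rsum_map in ho. fold pl in ho. simpl fst in ho. simpl snd in ho.
    rewrite (Rsum_ext _ (fun q =>
       c j * (fst q * al (snd q) * remainder pl (S n) (be (snd q))) +
       (fst q * (renewal pl n * u (snd q) j) +
        fst q * (be (snd q) * remainder pl (S n) (be (snd q)) * neighbour_mean (u (snd q)) j)))).
    - rewrite Rsum_plus, Rsum_scal, ho.
      rewrite Rmult_0_r, Rplus_0_l. apply Rsum_ext. intros; ring.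
    - intros q h.
      assert (e := hu q j h). rewrite remainder_S.
      rewrite e at 1.
      replace (fst q * (renewal pl n * u (snd q) j))
        with (fst q * (renewal pl n * (al (snd q) * c j + be (snd q) * neighbour_mean (u (snd q)) j)))
        by (rewrite <- e; reflexivity).
      ring. }
  (* Neighbour means preserve upper bounds, so each level of the recursion adds only [F] times one
     renewal coefficient. *)
  assert (hV0 : forall n E, (forall j, V n j <= E) ->
     forall j, V 0%nat j <= F * Rsum (renewal pl) (seq 0 n) + E).
  { induction n as [|n IH]; intros E hE j.
    - simpl. rewrite Rmult_0_r, Rplus_0_l. apply hE.
    - rewrite seq_S, Rsum_app, Rsum_cons. simpl Rsum at 2. simpl Nat.add.
      assert (hE' : forall j, V n j <= renewal pl n * F + E).
      { intros k. rewrite hV. pose proof (renewal_nonneg pl rho n hl).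
        apply Rplus_le_compat; [apply Rmult_le_compat_l; auto|].
        unfold neighbour_mean. pose proof (hE (k - 1)%Z). pose proof (hE (k + 1)%Z). lra. }
      specialize (IH _ hE' j). lra. }
  set (W := Rsum fst l).
  assert (hW : 0 <= W) by (apply Rsum_nonneg, hw).
  assert (hU0 : 0 <= U \/ l = []).
  { destruct l as [|q l']; [right; reflexivity|left].
    eapply Rle_trans; [|apply (hU q 0%Z); simpl; auto]. apply Rabs_pos. }
  destruct hU0 as [hU0|hnil].
  2:{ unfold f, mix. rewrite hnil. simpl. apply Rmult_le_pos; lra. }
  apply Rnot_lt_le. intros hlt.
  (* The tail [V n] is made at most half of the supposed excess over [rho * F]. *)
  destruct (linear_geometric_small rho (W * U) ((f i - rho * F) / 2)) as [n hn];
    [assumption|apply Rmult_le_pos; assumption|lra|].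
  assert (hVn : forall j, V n j <= W * U * (INR n + 1) * rho ^ n).
  { intros j. unfold V, mix.
    replace (W * U * (INR n + 1) * rho ^ n) with ((U * (INR n + 1) * rho ^ n) * W) by ring.
    unfold W. rewrite <- Rsum_scal. apply Rsum_le. intros q h.
    rewrite (Rmult_comm _ (fst q)). apply Rmult_le_compat_l; [auto|].
    assert (hbe : 0 < be (snd q) <= rho).
    { apply (hq (fst q * al (snd q), be (snd q))). unfold pl.
      apply (in_map (fun q => (fst q * al (snd q), be (snd q)))), h. }
    pose proof (remainder_upper pl rho n _ hl hbe).
    pose proof (remainder_lower pl rho n _ hl hbe).
    assert (0 < rho ^ n) by (apply pow_lt; lra). pose proof (pos_INR n).
    assert (0 <= INR n * rho ^ n) by (apply Rmult_le_pos; lra).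
    assert (hz : Rabs (be (snd q) * remainder pl n (be (snd q))) <= (INR n + 1) * rho ^ n).
    { apply Rabs_le. split; nra. }
    eapply Rle_trans; [apply Rle_abs|]. rewrite Rabs_mult.
    rewrite Rmult_assoc, (Rmult_comm U).
    apply Rmult_le_compat; auto using Rabs_pos. }
  pose proof (hV0 n _ hVn) as h0.
  pose proof (renewal_sum pl rho n hl).
  assert (F * Rsum (renewal pl) (seq 0 n) <= F * rho) by (apply Rmult_le_compat_l; lra).
  rewrite hfV in hlt, hn. unfold neighbour_mean in hlt, hn.
  pose proof (h0 (i - 1)%Z). pose proof (h0 (i + 1)%Z). lra.
Qed.

Definition geometric_kernel (s : R) (i j : Z) : R := s ^ Z.abs_nat (i - j).

Definition mixture_kernel (w : list (R * R)) (i j : Z) : R :=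
  Rsum (fun q => fst q * geometric_kernel (snd q) i j) w.

(* [s^|i-x|] is a multiple of a resolvent of the simple random walk on the integers. *)
Lemma geometric_kernel_resolvent (s : R) (i x : Z) : 0 < s < 1 ->
  geometric_kernel s i x = (1 - s * s) / (1 + s * s) * (if Z.eq_dec i x then 1 else 0)
    + 2 * s / (1 + s * s) * neighbour_mean (fun i => geometric_kernel s i x) i.
Proof.
  intros hs. unfold neighbour_mean, geometric_kernel.
  destruct (Z.eq_dec i x) as [<-|hne].
  - replace (i - i)%Z with 0%Z by lia. replace (i - 1 - i)%Z with (-1)%Z by lia.
    replace (i + 1 - i)%Z with 1%Z by lia. simpl. field. nra.
  - assert (h : exists n, (Z.abs_nat (i - x) = S n /\
      ((Z.abs_nat (i - 1 - x) = n /\ Z.abs_nat (i + 1 - x) = S (S n)) \/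
       (Z.abs_nat (i - 1 - x) = S (S n) /\ Z.abs_nat (i + 1 - x) = n)))%nat).
    { exists (pred (Z.abs_nat (i - x))). lia. }
    destruct h as [n [-> [[-> ->]|[-> ->]]]]; simpl; field; nra.
Qed.

(** Where the source [c] vanishes, the upper bound contracts by [rho]; elsewhere the point is a node
    and the value is at most [M]. Iterating from a crude bound drives the excess over [M] to 0. *)
Lemma mixture_max_principle (w : list (R * R)) :
  (forall q, In q w -> 0 <= fst q /\ 0 < snd q < 1) ->
  max_principle (mixture_kernel w).
Proof.
  intros hw l M t hM hl.
  set (al := fun s => (1 - s * s) / (1 + s * s)).
  set (be := fun s => 2 * s / (1 + s * s)).
  set (u := fun s i => comb (geometric_kernel s) l i).
  set (c := fun i => comb (fun i x => if Z.eq_dec i x then 1 else 0) l i).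
  set (f := mix w (fun _ => 1) u).
  assert (hf : forall i, comb (mixture_kernel w) l i = f i).
  { intros i. unfold f, mix, u, comb, mixture_kernel.
    rewrite (Rsum_ext _ (fun q => Rsum (fun q' => fst q * (fst q' * geometric_kernel (snd q') i (snd q))) w))
      by (intros; rewrite <- Rsum_scal; reflexivity).
    rewrite Rsum_swap. apply Rsum_ext. intros q _. rewrite <- Rsum_scal, <- Rsum_scal.
    apply Rsum_ext. intros; ring. }
  assert (hal : forall s, 0 < s < 1 -> 0 < al s).
  { intros s hs. unfold al. apply Rdiv_lt_0_compat; nra. }
  assert (hbe : forall s, 0 < s < 1 -> 0 < be s < 1).
  { intros s hs. unfold be. split; [apply Rdiv_lt_0_compat; nra|].
    apply Rmult_lt_reg_r with (1 + s * s); [nra|].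
    unfold Rdiv. rewrite Rmult_assoc, Rinv_l by nra. nra. }
  assert (hp : forall q, In q w -> 0 <= fst q * al (snd q)).
  { intros q h. destruct (hw q h) as [h1 h2]. specialize (hal _ h2). nra. }
  (* If the resolvent weights sum to 0, the whole mixture vanishes; otherwise their sum is positive,
     as [admissible] demands. *)
  destruct (Req_dec (Rsum (fun q => fst q * al (snd q)) w) 0) as [hz|hnz].
  { rewrite hf. unfold f, mix.
    rewrite (Rsum_ext _ (fun _ => 0)); [rewrite Rsum_zero; assumption|].
    intros q h. assert (e := Rsum_nonneg_zero _ w hp hz q h). cbv beta in e.
    destruct (hw q h) as [h1 h2]. specialize (hal _ h2).
    assert (fst q = 0) as -> by nra. ring. }
  assert (hrho : exists rho, 0 < rho < 1 /\ forall q, In q w -> be (snd q) <= rho).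
  { clear -hw hbe. induction w as [|q w IH].
    - exists (1/2). split; [lra|intros q []].
    - destruct IH as [rho [h1 h2]]; [intros; apply hw; simpl; auto|].
      exists (Rmax rho (be (snd q))).
      destruct (hw q (or_introl eq_refl)) as [_ hq]. specialize (hbe _ hq).
      split.
      + split; [apply Rlt_le_trans with rho; [lra|apply Rmax_l]|apply Rmax_lub_lt; lra].
      + intros q' [<-|h]; [apply Rmax_r|].
        eapply Rle_trans; [apply h2, h|apply Rmax_l]. }
  destruct hrho as [rho [hrho hbr]].
  set (U := Rsum (fun q => Rabs (fst q)) l).
  assert (hU : forall q i, In q w -> Rabs (u (snd q) i) <= U).
  { intros q i h. unfold u, comb. eapply Rle_trans; [apply Rabs_Rsum_le|].
    apply Rsum_le. intros q' _. rewrite Rabs_mult.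
    rewrite <- (Rmult_1_r (Rabs (fst q'))) at 2.
    apply Rmult_le_compat_l; [apply Rabs_pos|].
    destruct (hw q h) as [_ hs]. unfold geometric_kernel.
    rewrite Rabs_right by (apply Rle_ge, pow_le; lra).
    rewrite <- (pow1 (Z.abs_nat (i - snd q'))). apply pow_incr; lra. }
  assert (hadm : admissible (map (fun q => (fst q * al (snd q), be (snd q))) w) rho).
  { split; [|split; [assumption|]].
    - rewrite Rsum_map. simpl. pose proof (Rsum_nonneg _ _ hp). lra.
    - intros q h. apply in_map_iff in h. destruct h as [q' [<- h]]. simpl.
      destruct (hw q' h) as [h1 h2]. specialize (hal _ h2). pose proof (hbe _ h2).
      specialize (hbr q' h). split; [nra|lra]. }
  assert (hu : forall q i, In q w ->
     u (snd q) i = al (snd q) * c i + be (snd q) * neighbour_mean (u (snd q)) i).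
  { intros q i h. destruct (hw q h) as [_ hs].
    unfold u, c, comb, neighbour_mean. unfold Rdiv at 1.
    rewrite <- Rsum_plus, (Rmult_comm _ (/ 2)), <- !Rsum_scal, <- Rsum_plus.
    apply Rsum_ext. intros q' _. rewrite geometric_kernel_resolvent by assumption.
    unfold al, be, neighbour_mean. field. nra. }
  assert (hF : forall n i, f i <= Rmax M (rho ^ n * (Rsum fst w * U))).
  { induction n as [|n IH]; intros i.
    - eapply Rle_trans; [|apply Rmax_r]. rewrite pow_O, Rmult_1_l, Rmult_comm.
      unfold f, mix. rewrite <- Rsum_scal. apply Rsum_le. intros q h.
      rewrite (Rmult_comm U). apply Rmult_le_compat_l; [apply hw, h|].
      rewrite Rmult_1_l. eapply Rle_trans; [apply Rle_abs|apply hU, h].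
    - destruct (Req_dec (c i) 0) as [hci|hci].
      + assert (hM' := Rmax_l M (rho ^ n * (Rsum fst w * U))).
        assert (h := resolvent_mixture_contraction w al be u c rho _ U
           (fun q h => proj1 (hw q h)) hu hU hadm (Rle_trans _ _ _ hM hM') IH i hci).
        fold f in h. eapply Rle_trans; [exact h|].
        rewrite <- RmaxRmult by lra.
        apply Rmax_lub.
        * apply Rle_trans with M; [nra|apply Rmax_l].
        * rewrite <- Rmult_assoc. apply Rmax_r.
      + eapply Rle_trans; [|apply Rmax_l].
        assert (hin : exists q, In q l /\ snd q = i).
        { apply NNPP. intros hno. apply hci. unfold c, comb.
          rewrite (Rsum_ext _ (fun _ => 0)); [apply Rsum_zero|].
          intros q h. destruct (Z.eq_dec i (snd q)) as [e|_]; [|ring].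
          exfalso. apply hno. exists q. auto. }
        destruct hin as [q [h <-]]. rewrite <- hf. apply hl, h. }
  rewrite hf. apply Rnot_lt_le. intros hlt.
  assert (hFU : 0 <= Rsum fst w * U).
  { apply Rmult_le_pos; [apply Rsum_nonneg; intros; apply hw; assumption|].
    apply Rsum_nonneg; intros; apply Rabs_pos. }
  set (K := Rsum fst w * U + 1).
  destruct (pow_lt_1_zero rho ltac:(rewrite Rabs_right; lra) ((f t - M) / K)) as [n hn].
  { apply Rdiv_lt_0_compat; unfold K; lra. }
  specialize (hn n (le_n n)). specialize (hF n t).
  rewrite Rabs_right in hn by (apply Rle_ge, pow_le; lra).
  assert (0 < rho ^ n) by (apply pow_lt; lra).
  assert (rho ^ n * K < f t - M).
  { apply Rmult_lt_reg_r with (/ K); [apply Rinv_0_lt_compat; unfold K; lra|].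
    rewrite Rmult_assoc, Rinv_r by (unfold K; lra). unfold Rdiv in hn. lra. }
  revert hF. unfold K in *. unfold Rmax. destruct (Rle_dec M (rho ^ n * (Rsum fst w * U))); nra.
Qed.

(** * Moment approximation of totally monotone sequences *)

(** For moments [m k = E[x^k]] this is [E[x^k (1-x)^n]]; its nonnegativity is Hausdorff's
    condition. *)
Fixpoint iter_diff (m : nat -> R) (n k : nat) : R :=
  match n with
  | O => m k
  | S n => iter_diff m n k - iter_diff m n (S k)
  end.

Fixpoint falling (x : R) (j : nat) : R :=
  match j with
  | O => 1
  | S j => falling x j * (x - INR j)
  end.

Lemma falling_succ_l (x : R) (j : nat) : falling (x + 1) (S j) = (x + 1) * falling x j.
Proof.
  induction j as [|j IH]; [simpl; ring|].
  change (falling (x + 1) (S j) * (x + 1 - INR (S j)) = (x + 1) * falling x (S j)).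
  rewrite IH, S_INR. simpl. ring.
Qed.

Lemma falling_pascal (x : R) (j : nat) :
  falling (x + 1) (S j) = falling x (S j) + INR (S j) * falling x j.
Proof. rewrite falling_succ_l, S_INR. simpl. ring. Qed.

Lemma falling_zero (j : nat) : falling 0 (S j) = 0.
Proof. induction j as [|j IH]; [simpl; ring|]. change (falling 0 (S j) * (0 - INR (S j)) = 0). rewrite IH; ring. Qed.

(* One entry per 0-1 word of length [N]: the probability of the word under the exchangeable
   law with moments [m], and its number of ones. *)
Fixpoint word_weights (m : nat -> R) (N a b : nat) : list (R * nat) :=
  match N with
  | O => [(iter_diff m a b, b)]
  | S N => word_weights m N (S a) b ++ word_weights m N a (S b)
  end.

(** These are factorial moments of the number of ones in an exchangeable word. The induction is on
    the first letter: a leading one shifts the count, and [falling_pascal] accounts for the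
    shift. *)
Lemma word_weights_falling (m : nat -> R) (N : nat) : forall a b j,
  Rsum (fun q => fst q * falling (INR (snd q) - INR b) j) (word_weights m N a b)
    = falling (INR N) j * iter_diff m a (b + j).
Proof.
  induction N as [|N IH]; intros a b j.
  - simpl. rewrite Rminus_diag. destruct j as [|j].
    + rewrite Nat.add_0_r. simpl. ring.
    + rewrite falling_zero. ring.
  - cbn [word_weights]. rewrite Rsum_app, IH.
    destruct j as [|j].
    + assert (h := IH a (S b) 0%nat). cbn [falling] in *.
      rewrite h, !Nat.add_0_r. simpl. ring.
    + rewrite (Rsum_ext _ (fun q => fst q * falling (INR (snd q) - INR (S b)) (S j)
          + INR (S j) * (fst q * falling (INR (snd q) - INR (S b)) j))).
      * rewrite Rsum_plus, Rsum_scal, !IH, (S_INR N), falling_pascal.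
        replace (S b + S j)%nat with (S (b + S j)) by lia.
        replace (S b + j)%nat with (b + S j)%nat by lia.
        cbn [iter_diff]. ring.
      * intros q _. replace (INR (snd q) - INR b) with (INR (snd q) - INR (S b) + 1)
          by (rewrite S_INR; ring).
        rewrite falling_pascal. ring.
Qed.

Lemma word_weights_range (m : nat -> R) (N : nat) :
  (forall n k, 0 <= iter_diff m n k) ->
  forall a b q, In q (word_weights m N a b) -> 0 <= fst q /\ (b <= snd q <= b + N)%nat.
Proof.
  intros hm. induction N as [|N IH]; intros a b q h.
  - destruct h as [<-|[]]. simpl. split; [apply hm|lia].
  - simpl in h. apply in_app_or in h. destruct h as [h|h];
    destruct (IH _ _ _ h); split; auto; lia.
Qed.

Lemma falling_pos (N j : nat) : (j <= N)%nat -> 0 < falling (INR N) j.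
Proof.
  induction j as [|j IH]; intros h; [simpl; lra|].
  cbn [falling]. apply Rmult_lt_0_compat; [apply IH; lia|].
  apply lt_INR in h. lra.
Qed.

(** Each factor [(k - j) / (N - j)] is close to the frequency, and since all factors are at most 1
    in modulus the errors just add. The shifted frequency [(k + 1) / (N + 2)] stays strictly inside
    [(0, 1)], as the geometric kernels require. *)
Lemma falling_ratio_bound (N k J j : nat) : (k <= N)%nat -> (2 * J < N)%nat -> (j <= J)%nat ->
  Rabs (falling (INR k) j / falling (INR N) j) <= 1 /\
  Rabs (falling (INR k) j / falling (INR N) j - ((INR k + 1) / (INR N + 2)) ^ j)
    <= INR j * ((INR J + 1) / (INR N - INR J)).
Proof.
  intros hk hJ. induction j as [|j IH]; intros hj.
  - simpl. replace (1 / 1) with 1 by field. rewrite Rabs_R1, Rminus_diag, Rabs_R0. lra.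
  - destruct (IH ltac:(lia)) as [h1 h2].
    assert (hp := falling_pos N j ltac:(lia)).
    assert (hkR := le_INR _ _ hk). assert (hjR := lt_INR j J ltac:(lia)).
    assert (hJR : 2 * INR J < INR N) by (apply lt_INR in hJ; rewrite mult_INR in hJ; simpl in hJ; lra).
    assert (hj0 := pos_INR j). assert (hk0 := pos_INR k).
    set (d := (INR k - INR j) / (INR N - INR j)).
    set (s := (INR k + 1) / (INR N + 2)).
    set (e := (INR J + 1) / (INR N - INR J)).
    (* The numerator may be negative; [2 * J < N] still gives [|k - j| <= N - j]. *)
    assert (hd : Rabs d <= 1).
    { unfold d, Rdiv. rewrite Rabs_mult, (Rabs_right (/ _))
        by (apply Rle_ge, Rlt_le, Rinv_0_lt_compat; lra).
      apply Rmult_le_reg_r with (INR N - INR j); [lra|].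
      rewrite Rmult_assoc, Rinv_l by lra. rewrite Rmult_1_r, Rmult_1_l.
      apply Rabs_le; lra. }
    assert (hs : 0 <= s <= 1).
    { unfold s. split.
      - apply Rle_mult_inv_pos; lra.
      - apply Rmult_le_reg_r with (INR N + 2); [lra|].
        unfold Rdiv. rewrite Rmult_assoc, Rinv_l by lra. lra. }
    assert (hds : Rabs (d - s) <= e).
    { replace (d - s) with ((INR k * (2 + INR j) - INR N * (1 + INR j) - INR j)
          * / (INR N + 2) * / (INR N - INR j))
        by (unfold d, s; field; lra).
      rewrite !Rabs_mult, (Rabs_right (/ (INR N + 2))), (Rabs_right (/ (INR N - INR j)))
        by (apply Rle_ge, Rlt_le, Rinv_0_lt_compat; lra).
      unfold e. apply Rmult_le_compat.
      - apply Rmult_le_pos; [apply Rabs_pos|left; apply Rinv_0_lt_compat; lra].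
      - left; apply Rinv_0_lt_compat; lra.
      - apply Rmult_le_reg_r with (INR N + 2); [lra|].
        rewrite Rmult_assoc, Rinv_l, Rmult_1_r by lra.
        apply Rabs_le. split; nra.
      - apply Rinv_le_contravar; lra. }
    assert (heq : falling (INR k) (S j) / falling (INR N) (S j)
       = falling (INR k) j / falling (INR N) j * d).
    { unfold d. cbn [falling]. field. split; lra. }
    rewrite heq. set (x := falling (INR k) j / falling (INR N) j) in *.
    fold s in h2. fold e in h2.
    assert (hsj : 0 <= s ^ j <= 1).
    { split; [apply pow_le; lra|]. rewrite <- (pow1 j). apply pow_incr; lra. }
    split.
    + rewrite Rabs_mult. pose proof (Rabs_pos x). pose proof (Rabs_pos d). nra.
    + replace (x * d - s ^ S j) with (x * (d - s) + (x - s ^ j) * s) by (simpl; ring).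
      eapply Rle_trans; [apply Rabs_triang|].
      rewrite !Rabs_mult, S_INR, (Rabs_right s) by lra.
      pose proof (Rabs_pos x). pose proof (Rabs_pos (d - s)). pose proof (Rabs_pos (x - s ^ j)).
      assert (Rabs x * Rabs (d - s) <= 1 * e) by (apply Rmult_le_compat; lra).
      assert (Rabs (x - s ^ j) * s <= Rabs (x - s ^ j) * 1) by (apply Rmult_le_compat_l; lra).
      lra.
Qed.

Lemma hausdorff_approx (m : nat -> R) (J : nat) (e : R) :
  (forall n k, 0 <= iter_diff m n k) -> 0 < e ->
  exists w : list (R * R), (forall q, In q w -> 0 <= fst q /\ 0 < snd q < 1) /\
    forall j, (j <= J)%nat -> Rabs (m j - Rsum (fun q => fst q * snd q ^ j) w) <= e.
Proof.
  intros hm he.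
  set (C := m 0%nat * (INR J * (INR J + 1))).
  assert (hC : 0 <= C).
  { pose proof (hm 0%nat 0%nat) as h0. simpl in h0. pose proof (pos_INR J).
    apply Rmult_le_pos; [assumption|]. apply Rmult_le_pos; lra. }
  (* This size makes the final error [C / (N - J)] at most [e] and also gives [2 * J < N]. *)
  destruct (INR_unbounded (C / e + 2 * INR J)) as [N hN].
  assert (hCe : 0 <= C / e) by (apply Rle_mult_inv_pos; lra).
  pose proof (pos_INR J) as hJ0.
  assert (hJN : (2 * J < N)%nat) by (apply INR_lt; rewrite mult_INR; simpl; lra).
  set (ww := word_weights m N 0 0).
  assert (hr := word_weights_range m N hm 0 0). fold ww in hr.
  exists (map (fun q => (fst q, (INR (snd q) + 1) / (INR N + 2))) ww). split.
  - intros q h. apply in_map_iff in h. destruct h as [q' [<- h]]. simpl.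
    destruct (hr q' h) as [h1 [_ h2]]. split; [assumption|].
    apply le_INR in h2. rewrite plus_INR in h2. simpl in h2. pose proof (pos_INR (snd q')).
    split; [apply Rdiv_lt_0_compat; lra|].
    apply Rmult_lt_reg_r with (INR N + 2); [lra|].
    unfold Rdiv. rewrite Rmult_assoc, Rinv_l by lra. lra.
  - intros j hj. rewrite Rsum_map. simpl.
    assert (hfp := falling_pos N j ltac:(lia)).
    assert (hmj : m j = Rsum (fun q => fst q * (falling (INR (snd q)) j / falling (INR N) j)) ww).
    { pose proof (word_weights_falling m N 0 0 j) as h. fold ww in h. simpl in h.
      apply Rmult_eq_reg_l with (falling (INR N) j); [|lra].
      rewrite <- h, <- Rsum_scal. apply Rsum_ext. intros q _.
      rewrite Rminus_0_r. field. lra. }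
    assert (hm0 : Rsum fst ww = m 0%nat).
    { pose proof (word_weights_falling m N 0 0 0) as h. fold ww in h. simpl in h.
      rewrite Rmult_1_l in h. rewrite <- h. apply Rsum_ext; intros; ring. }
    rewrite hmj.
    replace (Rsum (fun q => fst q * (falling (INR (snd q)) j / falling (INR N) j)) ww -
      Rsum (fun q => fst q * ((INR (snd q) + 1) / (INR N + 2)) ^ j) ww)
     with (Rsum (fun q => fst q * (falling (INR (snd q)) j / falling (INR N) j
              - ((INR (snd q) + 1) / (INR N + 2)) ^ j)) ww).
    2:{ rewrite (Rsum_ext _ (fun q => fst q * (falling (INR (snd q)) j / falling (INR N) j)
            + (-1) * (fst q * ((INR (snd q) + 1) / (INR N + 2)) ^ j))) by (intros; ring).
        rewrite Rsum_plus, Rsum_scal. ring. }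
    eapply Rle_trans; [apply Rabs_Rsum_le|].
    apply Rle_trans with (Rsum (fun q => INR J * ((INR J + 1) / (INR N - INR J)) * fst q) ww).
    + apply Rsum_le. intros q h. destruct (hr q h) as [h1 [_ h2]].
      rewrite Rabs_mult, (Rabs_right (fst q)), Rmult_comm by lra.
      apply Rmult_le_compat_r; [assumption|].
      destruct (falling_ratio_bound N (snd q) J j) as [_ hb]; [lia|assumption|assumption|].
      eapply Rle_trans; [exact hb|]. apply Rmult_le_compat_r; [|apply le_INR, hj].
      apply Rle_mult_inv_pos; lra.
    + rewrite Rsum_scal, hm0.
      replace (INR J * ((INR J + 1) / (INR N - INR J)) * m 0%nat) with (C / (INR N - INR J))
        by (unfold C; field; lra).
      apply Rmult_le_reg_r with (INR N - INR J); [lra|].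
      unfold Rdiv at 1. rewrite Rmult_assoc, Rinv_l, Rmult_1_r by lra.
      replace C with (e * (C / e)) by (field; lra).
      apply Rmult_le_compat_l; lra.
Qed.

Lemma totally_monotone_max_principle (m : nat -> R) :
  (forall n k, 0 <= iter_diff m n k) ->
  max_principle (fun i j => m (Z.abs_nat (i - j))).
Proof.
  intros hm. apply max_principle_limit. intros pts e he.
  assert (hJ : exists J, forall s t, In s pts -> In t pts -> (Z.abs_nat (s - t) <= J)%nat).
  { assert (hb : exists b, forall s, In s pts -> (Z.abs s <= b)%Z).
    { clear. induction pts as [|x pts [b hb]]; [exists 0%Z; intros s []|].
      exists (Z.max (Z.abs x) b). intros s [<-|h]; [lia|]. specialize (hb s h). lia. }
    destruct hb as [b hb]. exists (Z.abs_nat (2 * b)). intros s t h1 h2.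
    specialize (hb s h1) as h1'. specialize (hb t h2). lia. }
  destruct hJ as [J hJ].
  destruct (hausdorff_approx m J e hm he) as [w [hw happ]].
  exists (mixture_kernel w). split; [apply mixture_max_principle, hw|].
  intros s t hs ht. apply happ, hJ; assumption.
Qed.

(** * Completely monotone functions of a power *)

(** This is [CMF] without its condition at 0, which is carried separately as right continuity. *)
Definition alternating_derivatives (g : R -> R) : Prop :=
  exists D : nat -> R -> R,
    (forall x, 0 < x -> D 0%nat x = g x) /\
    (forall n x, 0 < x -> derivable_pt_lim (D n) x (D (S n) x)) /\
    (forall n x, 0 < x -> 0 <= (-1) ^ n * D n x).

Definition right_continuous (g : R -> R) (t : R) : Prop :=
  forall e, 0 < e -> exists d, 0 < d /\ forall s, t <= s < t + d -> Rabs (g s - g t) < e.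

Definition step_diff (h : R) (g : R -> R) (t : R) : R := g t - g (t + h).

(** Steps of different sizes are allowed: grid sampling uses equal steps, the modulus of continuity
    two unequal ones. *)
Definition totally_monotone (g : R -> R) : Prop :=
  forall hs t, Forall (fun h => 0 <= h) hs -> 0 <= t -> 0 <= fold_right step_diff g hs t.

(** By the mean value theorem, the [n]-th derivative of the difference is [-h] times a derivative of
    order [n + 1] of [g], which has the right sign. *)
Lemma alternating_derivatives_diff (g : R -> R) (h : R) :
  0 <= h -> alternating_derivatives g -> alternating_derivatives (step_diff h g).
Proof.
  intros hh [D [h0 [h1 h2]]].
  exists (fun n x => D n x - D n (x + h)). unfold step_diff. split; [|split].
  - intros x hx. rewrite !h0; lra.
  - intros n x hx.
    apply (derivable_pt_lim_minus (D n) (fun x => D n (x + h))); [apply h1, hx|].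
    replace (D (S n) (x + h)) with (D (S n) (x + h) * (1 + 0)) by ring.
    apply (derivable_pt_lim_comp (fun x => x + h) (D n)).
    + apply derivable_pt_lim_plus; [apply derivable_pt_lim_id|apply derivable_pt_lim_const].
    + apply h1. lra.
  - intros n x hx. destruct (Req_dec h 0) as [->|hne].
    { rewrite Rplus_0_r, Rminus_diag. lra. }
    destruct (MVT_cor2 (D n) (D (S n)) x (x + h)) as [c [e hc]]; [lra| |].
    { intros c hc. apply h1. lra. }
    replace (D n x - D n (x + h)) with (- (D (S n) c * (x + h - x))) by lra.
    specialize (h2 (S n) c ltac:(lra)). simpl in h2. nra.
Qed.

Lemma right_continuous_diff (g : R -> R) (h : R) :
  0 <= h -> (forall t, 0 <= t -> right_continuous g t) ->
  forall t, 0 <= t -> right_continuous (step_diff h g) t.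
Proof.
  intros hh hg t ht e he.
  destruct (hg t ht (e / 2)) as [d1 [hd1 H1]]; [lra|].
  destruct (hg (t + h) ltac:(lra) (e / 2)) as [d2 [hd2 H2]]; [lra|].
  exists (Rmin d1 d2). split; [apply Rmin_glb_lt; assumption|].
  intros s hs. pose proof (Rmin_l d1 d2). pose proof (Rmin_r d1 d2).
  specialize (H1 s ltac:(lra)). specialize (H2 (s + h) ltac:(lra)).
  apply Rabs_def2 in H1, H2. unfold step_diff. apply Rabs_def1; lra.
Qed.

(** Differencing preserves both hypotheses, so iterated differences are nonnegative on the open
    half-line; right continuity carries this to 0. *)
Lemma alternating_totally_monotone (g : R -> R) :
  alternating_derivatives g -> (forall t, 0 <= t -> right_continuous g t) ->
  totally_monotone g.
Proof.
  intros hg hc hs t hhs ht.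
  assert (h : alternating_derivatives (fold_right step_diff g hs) /\
     forall t, 0 <= t -> right_continuous (fold_right step_diff g hs) t).
  { induction hhs as [|h hs hh _ [IH1 IH2]]; [split; assumption|].
    split; [apply alternating_derivatives_diff|apply right_continuous_diff]; assumption. }
  destruct h as [[D [h0 [_ h2]]] hcont].
  set (f := fold_right step_diff g hs) in *.
  assert (hpos : forall x, 0 < x -> 0 <= f x).
  { intros x hx. rewrite <- h0 by assumption. specialize (h2 0%nat x hx). simpl in h2. lra. }
  destruct (Rle_or_lt 0 (f t)) as [|hlt]; [assumption|exfalso].
  destruct (hcont t ht (- f t)) as [d [hd H]]; [lra|].
  specialize (H (t + d / 2) ltac:(lra)). specialize (hpos (t + d / 2) ltac:(lra)).
  apply Rabs_def2 in H. lra.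
Qed.

(* [(c, (k, q))] stands for the function [c (-1)^k phi^(k)(t^p) t^(-q)]; minus the derivative
   of a sum of such functions with [c, q >= 0] is again one. *)
Definition power_term (D : nat -> R -> R) (p : R) (x : R * (nat * R)) (t : R) : R :=
  fst x * (((-1) ^ fst (snd x) * D (fst (snd x)) (Rpower t p)) * Rpower t (- snd (snd x))).

Definition power_term_next (p : R) (x : R * (nat * R)) : list (R * (nat * R)) :=
  [(fst x * p, (S (fst (snd x)), snd (snd x) + 1 - p));
   (fst x * snd (snd x), (fst (snd x), snd (snd x) + 1))].

Lemma power_term_derivative (D : nat -> R -> R) (p : R) (x : R * (nat * R)) (t : R) :
  (forall n x, 0 < x -> derivable_pt_lim (D n) x (D (S n) x)) -> 0 < t ->
  derivable_pt_lim (power_term D p x) t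
    (- Rsum (fun y => power_term D p y t) (power_term_next p x)).
Proof.
  intros hD ht. destruct x as [c [k q]].
  unfold power_term, power_term_next, Rsum. simpl fold_right. cbn [fst snd].
  assert (hp : 0 < Rpower t p) by apply exp_pos.
  assert (d1 : derivable_pt_lim (fun t => Rpower t p) t (p * Rpower t (p - 1)))
    by (apply derivable_pt_lim_power, ht).
  assert (d2 := derivable_pt_lim_comp _ _ _ _ _ d1 (hD k _ hp)).
  assert (d3 : derivable_pt_lim (fun t => Rpower t (- q)) t (- q * Rpower t (- q - 1)))
    by (apply derivable_pt_lim_power, ht).
  assert (d4 := derivable_pt_lim_mult _ _ _ _ _
     (derivable_pt_lim_scal _ ((-1) ^ k) _ _ d2) d3).
  assert (d5 := derivable_pt_lim_scal _ c _ _ d4).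
  unfold mult_real_fct, mult_fct, comp in d5.
  match type of d5 with derivable_pt_lim _ _ ?l => match goal with
    |- derivable_pt_lim _ _ ?l' => replace l' with l; [exact d5|] end end.
  replace (- (q + 1 - p)) with ((p - 1) + - q) by ring.
  replace (- (q + 1)) with (- q - 1) by ring.
  rewrite Rpower_plus. simpl pow. ring.
Qed.

Fixpoint power_terms (p : R) (n : nat) : list (R * (nat * R)) :=
  match n with
  | O => [(1, (O, 0))]
  | S n => flat_map (power_term_next p) (power_terms p n)
  end.

(** The bound [p <= 1] keeps the exponent increment [1 - p] nonnegative, and exponents reappear as
    factors of later coefficients. *)
Lemma power_terms_nonneg (p : R) (n : nat) : 0 < p <= 1 ->
  forall x, In x (power_terms p n) -> 0 <= fst x /\ 0 <= snd (snd x).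
Proof.
  intros hp. induction n as [|n IH]; intros x hx.
  - destruct hx as [<-|[]]. simpl. lra.
  - apply in_flat_map in hx. destruct hx as [y [hy hx]].
    destruct (IH y hy). destruct hx as [<-|[<-|[]]]; simpl; split; nra.
Qed.

Lemma alternating_derivatives_power (phi : R -> R) (p : R) :
  alternating_derivatives phi -> 0 < p <= 1 ->
  alternating_derivatives (fun t => phi (rpow t p)).
Proof.
  intros [D [h0 [h1 h2]]] hp.
  exists (fun n t => (-1) ^ n * Rsum (fun x => power_term D p x t) (power_terms p n)).
  split; [|split].
  - intros t ht. unfold rpow. destruct (Req_EM_T t 0) as [e|_]; [lra|].
    rewrite <- h0 by apply exp_pos. unfold power_term, Rsum. simpl.
    rewrite Ropp_0, Rpower_O by assumption. ring.
  - intros n t ht.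
    replace ((-1) ^ S n * Rsum (fun x => power_term D p x t) (power_terms p (S n)))
      with ((-1) ^ n * - Rsum (fun x => power_term D p x t) (power_terms p (S n)))
      by (simpl; ring).
    apply (derivable_pt_lim_scal (fun t => Rsum (fun x => power_term D p x t) (power_terms p n))).
    cbn [power_terms]. generalize (power_terms p n). intros l.
    induction l as [|x l IH].
    + simpl. rewrite Ropp_0. apply derivable_pt_lim_const.
    + cbn [flat_map]. rewrite Rsum_app, Ropp_plus_distr.
      apply (derivable_pt_lim_plus (power_term D p x)); [|exact IH].
      apply power_term_derivative; assumption.
  - intros n t ht. rewrite <- Rmult_assoc, <- Rpow_mult_distr.
    replace (-1 * -1) with 1 by ring. rewrite pow1, Rmult_1_l.
    apply Rsum_nonneg. intros x hx. destruct (power_terms_nonneg p n hp x hx).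
    unfold power_term. apply Rmult_le_pos; [assumption|].
    apply Rmult_le_pos; [apply h2, exp_pos|left; apply exp_pos].
Qed.

Lemma CMF_power_right_continuous (phi : R -> R) (p : R) : CMF phi -> 0 < p <= 1 ->
  forall t, 0 <= t -> right_continuous (fun t => phi (rpow t p)) t.
Proof.
  intros hphi hp t ht.
  assert (halt : alternating_derivatives phi)
    by (destruct hphi as [D [h0 [h1 [_ h2]]]]; exists D; auto).
  destruct hphi as [_ [_ [_ [hc _]]]].
  destruct (Req_dec t 0) as [->|hne].
  - intros e he. destruct (hc e he) as [d [hd H]].
    exists (Rpower d (/ p)). split; [apply exp_pos|].
    intros s hs. replace (rpow 0 p) with 0
      by (unfold rpow; destruct (Req_EM_T 0 0); [reflexivity|lra]).
    apply H. unfold rpow. destruct (Req_EM_T s 0); [lra|].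
    split; [left; apply exp_pos|].
    replace d with (Rpower (Rpower d (/ p)) p).
    + apply Rlt_Rpower_l; lra.
    + rewrite Rpower_mult, Rinv_l, Rpower_1; lra.
  - destruct (alternating_derivatives_power phi p halt hp) as [D [h0 [h1 _]]].
    assert (hcont : continuity_pt (D 0%nat) t).
    { apply derivable_continuous_pt. exists (D 1%nat t). apply h1. lra. }
    intros e he. destruct (hcont e he) as [d [hd H]].
    exists d. split; [assumption|]. intros s hs.
    rewrite <- !h0 by lra.
    destruct (Req_dec s t) as [->|hst]; [rewrite Rminus_diag, Rabs_R0; assumption|].
    apply H. split; [split; [exact I|auto]|]. simpl. unfold Rdist.
    rewrite Rabs_right; lra.
Qed.

Lemma CMF_power_totally_monotone (phi : R -> R) (p : R) : CMF phi -> 0 < p <= 1 ->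
  totally_monotone (fun t => phi (rpow t p)).
Proof.
  intros hphi hp. apply alternating_totally_monotone.
  - apply alternating_derivatives_power; [|assumption].
    destruct hphi as [D [h0 [h1 [_ h2]]]]; exists D; auto.
  - apply CMF_power_right_continuous; assumption.
Qed.

Lemma totally_monotone_nonneg (g : R -> R) (t : R) :
  totally_monotone g -> 0 <= t -> 0 <= g t.
Proof. intros hg ht. apply (hg [] t); auto. Qed.

Lemma totally_monotone_decr (g : R -> R) (s t : R) :
  totally_monotone g -> 0 <= s <= t -> g t <= g s.
Proof.
  intros hg hst. assert (h : 0 <= t - s) by lra.
  pose proof (hg [t - s] s ltac:(apply Forall_cons; [assumption|apply Forall_nil]) ltac:(lra)) as H.
  simpl in H. unfold step_diff in H. replace (s + (t - s)) with t in H by ring. lra.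
Qed.

(** The second difference at 0 with steps [a] and [b - a] shows that [g] drops most over an interval
    of given length when the interval starts at 0. *)
Lemma totally_monotone_modulus (g : R -> R) (a b d : R) :
  totally_monotone g -> 0 <= a -> 0 <= b -> Rabs (a - b) <= d ->
  Rabs (g a - g b) <= g 0 - g d.
Proof.
  intros hg. revert a b.
  assert (hw : forall a b, 0 <= a <= b -> b - a <= d -> 0 <= g a - g b <= g 0 - g d).
  { intros a b hab hd. pose proof (totally_monotone_decr g a b hg hab).
    pose proof (totally_monotone_decr g (b - a) d hg ltac:(lra)).
    pose proof (hg [a; b - a] 0 ltac:(repeat (apply Forall_cons; [lra|]); apply Forall_nil) ltac:(lra)) as H1.
    simpl in H1. unfold step_diff in H1.
    replace (0 + a + (b - a)) with b in H1 by ring.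
    replace (0 + (b - a)) with (b - a) in H1 by ring.
    replace (0 + a) with a in H1 by ring. lra. }
  intros a b ha hb hd. destruct (Rle_or_lt a b) as [hle|hlt].
  - specialize (hw a b ltac:(lra)). rewrite Rabs_left1 in hd by lra.
    rewrite Rabs_right; lra.
  - specialize (hw b a ltac:(lra)). rewrite Rabs_right in hd by lra.
    rewrite Rabs_left1; lra.
Qed.

Lemma iter_diff_sample (g : R -> R) (h : R) (n : nat) : forall k,
  iter_diff (fun j => g (INR j * h)) n k = fold_right step_diff g (repeat h n) (INR k * h).
Proof.
  induction n as [|n IH]; intros k; [reflexivity|].
  cbn [iter_diff repeat fold_right]. rewrite !IH, S_INR. unfold step_diff.
  replace ((INR k + 1) * h) with (INR k * h + h) by ring. reflexivity.
Qed.

(** Rounding both points to a grid of width [h] changes their distance by at most [h], hence the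
    kernel by at most [g 0 - g h]. On the grid the kernel comes from a totally monotone sequence. *)
Lemma kernel_max_principle (g : R -> R) :
  totally_monotone g -> right_continuous g 0 ->
  max_principle (fun s t => g (Rabs (s - t))).
Proof.
  intros hg hc. apply max_principle_limit. intros pts e he.
  destruct (hc e he) as [d [hd H]].
  set (h := d / 2).
  exists (fun s t => g (INR (Z.abs_nat (up (s / h) - up (t / h))) * h)). split.
  - apply (max_principle_pullback (fun s => up (s / h))
       (fun i j => g (INR (Z.abs_nat (i - j)) * h))).
    apply (totally_monotone_max_principle (fun j => g (INR j * h))).
    intros n k. rewrite iter_diff_sample. apply hg.
    + clear -hd. induction n; simpl; constructor; unfold h; [lra|assumption].
    + apply Rmult_le_pos; [apply pos_INR|unfold h; lra].
  - intros s t _ _.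
    assert (hh : 0 < h) by (unfold h; lra).
    apply Rle_trans with (g 0 - g h).
    + apply totally_monotone_modulus; auto using Rabs_pos.
      * apply Rmult_le_pos; [apply pos_INR|lra].
      * rewrite INR_IZR_INZ, Zabs2Nat.id_abs, abs_IZR, minus_IZR.
        rewrite <- (Rabs_right h) at 3 by lra. rewrite <- Rabs_mult.
        eapply Rle_trans; [apply Rabs_triang_inv2|].
        destruct (archimed (s / h)) as [s1 s2]. destruct (archimed (t / h)) as [t1 t2].
        assert (es : s = s / h * h) by (field; lra).
        assert (et : t = t / h * h) by (field; lra).
        replace (s - t - (IZR (up (s / h)) - IZR (up (t / h))) * h)
          with (((s / h - IZR (up (s / h))) - (t / h - IZR (up (t / h)))) * h) by (field; lra).
        rewrite Rabs_mult, (Rabs_right h) by lra.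
        apply Rle_trans with (1 * h); [|lra]. apply Rmult_le_compat_r; [lra|].
        apply Rabs_le; lra.
    + specialize (H h ltac:(unfold h; lra)). apply Rabs_def2 in H. lra.
Qed.

(** * Strictness and recovery *)

(** Decay is encoded by the existence of arbitrarily small values, which for a nonincreasing
    nonnegative [g] amounts to limit 0. *)
Definition decaying_profile (g : R -> R) : Prop :=
  totally_monotone g /\ right_continuous g 0 /\ g 0 = 1 /\
  forall e, e > 0 -> exists t, 0 < t /\ g t < e.

(** Apply the maximum principle with bound 0 to [g s] times the translate at 0 minus the translate
    at [- s]: it vanishes at 0 and equals [g s * g s - 1 <= 0] at [- s]. *)
Lemma profile_supermultiplicative (g : R -> R) (s t : R) :
  decaying_profile g -> 0 <= s -> 0 <= t -> g s * g t <= g (s + t).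
Proof.
  intros [hg [hc [h0 _]]] hs ht.
  pose proof (kernel_max_principle g hg hc [(-1, - s); (g s, 0)] 0 t (Rle_refl 0)) as h.
  pose proof (totally_monotone_decr g 0 s hg ltac:(lra)).
  pose proof (totally_monotone_nonneg g s hg hs).
  unfold comb, Rsum in h. simpl in h.
  replace (t - - s) with (s + t) in h by ring.
  rewrite Rminus_0_r, (Rabs_right t), (Rabs_right (s + t)) in h by lra.
  assert (h' : -1 * g (s + t) + (g s * g t + 0) <= 0); [|lra].
  apply h. intros q [<-|[<-|[]]]; simpl.
  - replace (- s - - s) with 0 by ring. replace (- s - 0) with (- s) by ring.
    rewrite Rabs_Ropp, Rabs_R0, Rabs_right, h0 by lra. nra.
  - replace (0 - - s) with s by ring. rewrite Rminus_0_r.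
    rewrite Rabs_R0, Rabs_right, h0 by lra. lra.
Qed.

(** A zero at [t] would force, by supermultiplicativity, zeros at all [t / 2^n], against right
    continuity at 0 and [g 0 = 1]. *)
Lemma profile_pos (g : R -> R) (t : R) : decaying_profile g -> 0 <= t -> 0 < g t.
Proof.
  intros hg ht. assert (hg' := hg). destruct hg' as [htm [hc [h0 _]]].
  destruct (totally_monotone_nonneg g t htm ht) as [|hz]; [assumption|exfalso].
  assert (hn : forall n, g (t * (/ 2) ^ n) = 0).
  { induction n as [|n IH]; [simpl; rewrite Rmult_1_r; auto|].
    assert (hp : 0 <= t * (/ 2) ^ S n) by (apply Rmult_le_pos; [lra|apply pow_le; lra]).
    pose proof (profile_supermultiplicative g _ _ hg hp hp) as h.
    replace (t * (/ 2) ^ S n + t * (/ 2) ^ S n) with (t * (/ 2) ^ n) in h by (simpl; field).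
    rewrite IH in h. nra. }
  destruct (hc 1 ltac:(lra)) as [d [hd H]].
  destruct (pow_lt_1_zero (/ 2) ltac:(rewrite Rabs_right; lra) (d / (t + 1))) as [n hN].
  { apply Rdiv_lt_0_compat; lra. }
  specialize (hN n (le_n n)).
  assert (hp : 0 < (/ 2) ^ n) by (apply pow_lt; lra).
  rewrite Rabs_right in hN by lra.
  assert ((t + 1) * (/ 2) ^ n < d).
  { apply (Rmult_lt_compat_l (t + 1)) in hN; [|lra].
    replace ((t + 1) * (d / (t + 1))) with d in hN by (field; lra). exact hN. }
  specialize (H (t * (/ 2) ^ n) ltac:(split; nra)).
  rewrite hn, h0 in H. apply Rabs_def2 in H. lra.
Qed.

(** Otherwise the second difference vanishes at [t]; being nonnegative and nonincreasing along
    [t + n d], it vanishes at all these points. So [g] is affine there: a negative slope contradicts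
    nonnegativity, a zero slope contradicts decay. *)
Lemma profile_strictly_convex (g : R -> R) (t d : R) :
  decaying_profile g -> 0 <= t -> 0 < d -> 2 * g (t + d) < g t + g (t + 2 * d).
Proof.
  intros hg ht hd. apply Rnot_le_lt. intros hle.
  assert (hg' := hg). destruct hg' as [htm [_ [_ hlim]]].
  set (D2 := step_diff d (step_diff d g)).
  assert (hF : forall n, Forall (fun h => 0 <= h) (repeat d n))
    by (induction n; simpl; constructor; [lra|assumption]).
  assert (htn : forall n, 0 <= t + INR n * d)
    by (intros n; pose proof (pos_INR n); nra).
  assert (hS : forall n, t + INR (S n) * d = t + INR n * d + d)
    by (intros; rewrite S_INR; ring).
  assert (hD2 : forall n, D2 (t + INR n * d) = 0).
  { induction n as [|n IH].
    - pose proof (htm _ _ (hF 2%nat) (htn 0%nat)) as h.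
      change (0 <= D2 (t + INR 0 * d)) in h. revert h.
      unfold D2, step_diff. simpl INR. rewrite Rmult_0_l, Rplus_0_r.
      replace (t + d + d) with (t + 2 * d) by ring. lra.
    - pose proof (htm _ _ (hF 2%nat) (htn (S n))) as h.
      change (0 <= D2 (t + INR (S n) * d)) in h.
      pose proof (htm _ _ (hF 3%nat) (htn n)) as h'.
      change (0 <= D2 (t + INR n * d) - D2 (t + INR n * d + d)) in h'.
      rewrite <- hS, IH in h'. lra. }
  set (c := g t - g (t + d)).
  assert (hlin : forall n, g (t + INR n * d) = g t - INR n * c /\
                           step_diff d g (t + INR n * d) = c).
  { induction n as [|n [IH1 IH2]].
    - simpl. rewrite Rmult_0_l, Rplus_0_r. split; [ring|reflexivity].
    - specialize (hD2 n). unfold D2 in hD2. unfold step_diff at 1 in hD2.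
      rewrite <- hS, IH2 in hD2. split; [|lra].
      unfold step_diff in IH2. rewrite <- hS in IH2. rewrite S_INR at 2. lra. }
  assert (hc : 0 <= c).
  { unfold c. pose proof (totally_monotone_decr g t (t + d) htm ltac:(lra)). lra. }
  assert (hgt := profile_pos g t hg ht).
  destruct hc as [hc|hc].
  - destruct (INR_unbounded (g t / c)) as [n hn].
    destruct (hlin n) as [h1 _].
    pose proof (totally_monotone_nonneg g _ htm (htn n)).
    apply (Rmult_lt_compat_r c) in hn; [|assumption].
    unfold Rdiv in hn. rewrite Rmult_assoc, Rinv_l, Rmult_1_r in hn by lra. lra.
  - destruct (hlim (g t) hgt) as [T [hT0 hT]].
    destruct (INR_unbounded (T / d)) as [n hn].
    destruct (hlin n) as [h1 _]. rewrite <- hc in h1.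
    apply (Rmult_lt_compat_r d) in hn; [|assumption].
    unfold Rdiv in hn. rewrite Rmult_assoc, Rinv_l, Rmult_1_r in hn by lra.
    pose proof (totally_monotone_decr g T (t + INR n * d) htm ltac:(lra)). lra.
Qed.

Lemma profile_lt_1 (g : R -> R) (t : R) : decaying_profile g -> 0 < t -> g t < 1.
Proof.
  intros hg ht. assert (hg' := hg). destruct hg' as [htm [_ [h0 _]]].
  pose proof (profile_strictly_convex g 0 t hg ltac:(lra) ht) as h.
  pose proof (totally_monotone_decr g t (2 * t) htm ltac:(lra)).
  rewrite !Rplus_0_l, h0 in h. lra.
Qed.

Lemma finite_gap {A : Type} (F : A -> R) (a : R) (l : list A) :
  (forall x, In x l -> a < F x) -> exists b, a < b /\ forall x, In x l -> b <= F x.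
Proof.
  induction l as [|x l IH]; intros h.
  - exists (a + 1). split; [lra|intros x []].
  - destruct IH as [b [hb H]]; [intros; apply h; simpl; auto|].
    exists (Rmin (F x) b). split.
    + apply Rmin_glb_lt; [apply h; simpl; auto|assumption].
    + intros y [<-|hy]; [apply Rmin_l|].
      eapply Rle_trans; [apply Rmin_r|auto].
Qed.

(* If the bound is attained at [t], subtract a multiple of
   [s -> g(|s - (t - K)|) + g(|s - (t + K)|)] with [K] large: by strict convexity of [g] this
   function has its strict minimum over [t - K, t + K] at [t], so the difference would be
   nonpositive on its nodes but positive at [t]. *)
Lemma strict_max_principle (g : R -> R) (l : list (R * R)) (M t : R) :
  decaying_profile g -> 0 < M -> ~ In t (map snd l) ->
  (forall q, In q l -> comb (fun s t => g (Rabs (s - t))) l (snd q) <= M) ->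
  comb (fun s t => g (Rabs (s - t))) l t < M.
Proof.
  intros hg hM ht hl. assert (hg' := hg). destruct hg' as [htm [hc _]].
  assert (hmp := kernel_max_principle g htm hc).
  set (k := fun s t => g (Rabs (s - t))) in *.
  apply Rnot_le_lt. intros hle.
  assert (hK : exists K, 0 < K /\ forall x, In x (map snd l) -> Rabs (x - t) <= K).
  { generalize (map snd l). clear. intros l. induction l as [|x l [K [hK H]]].
    - exists 1. split; [lra|intros x []].
    - exists (Rmax (Rabs (x - t)) K). split; [eapply Rlt_le_trans; [exact hK|apply Rmax_r]|].
      intros y [<-|hy]; [apply Rmax_l|]. eapply Rle_trans; [apply H, hy|apply Rmax_r]. }
  destruct hK as [K [hK hlK]].
  set (pts := map snd l ++ [t - K; t + K]).
  set (w := fun s => k s (t - K) + k s (t + K)).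
  assert (hwt : w t = 2 * g K).
  { unfold w, k. replace (t - (t - K)) with K by ring.
    replace (t - (t + K)) with (- K) by ring.
    rewrite Rabs_Ropp, Rabs_right by lra. ring. }
  assert (hw : forall x, In x pts -> w t < w x).
  { intros x hx.
    assert (hd : 0 < Rabs (x - t) <= K).
    { apply in_app_or in hx. destruct hx as [hx|[<-|[<-|[]]]].
      - split; [|apply hlK, hx]. apply Rabs_pos_lt. intros e.
        apply ht. replace t with x by lra. exact hx.
      - replace (t - K - t) with (- K) by ring. rewrite Rabs_Ropp, Rabs_right; lra.
      - replace (t + K - t) with K by ring. rewrite Rabs_right; lra. }
    rewrite hwt. set (d := Rabs (x - t)) in *.
    pose proof (profile_strictly_convex g (K - d) d hg ltac:(lra) ltac:(lra)) as h.
    replace (K - d + d) with K in h by ring.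
    replace (K - d + 2 * d) with (K + d) in h by ring.
    unfold w, k. unfold d in h, hd. destruct (Rle_or_lt 0 (x - t)).
    - rewrite Rabs_right in h, hd by lra.
      rewrite (Rabs_right (x - (t - K))), (Rabs_left1 (x - (t + K))) by lra.
      replace (x - (t - K)) with (K + (x - t)) by ring.
      replace (- (x - (t + K))) with (K - (x - t)) by ring. lra.
    - rewrite Rabs_left in h, hd by lra.
      rewrite (Rabs_right (x - (t - K))), (Rabs_left1 (x - (t + K))) by lra.
      replace (x - (t - K)) with (K - - (x - t)) by ring.
      replace (- (x - (t + K))) with (K + - (x - t)) by ring. lra. }
  destruct (finite_gap w (w t) pts hw) as [kap [hkap H]].
  assert (hwt0 : 0 <= w t).
  { rewrite hwt. pose proof (profile_pos g K hg ltac:(lra)). lra. }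
  (* With this factor the difference is at most [M - e * kap = 0] on the nodes, while at [t] it is
     at least [e * (kap - w t) > 0]. *)
  set (e := M / kap).
  assert (he : 0 < e) by (apply Rdiv_lt_0_compat; lra).
  assert (hek : e * kap = M) by (unfold e; field; lra).
  set (l' := l ++ [(- e, t - K); (- e, t + K)]).
  assert (hl' : forall s, comb k l' s = comb k l s - e * w s).
  { intros s. unfold l', comb. rewrite Rsum_app. unfold w, Rsum. simpl. ring. }
  assert (hmap : map snd l' = pts) by (unfold l', pts; rewrite map_app; reflexivity).
  assert (h : comb k l' t <= 0).
  { apply hmp; [lra|]. intros q hq. rewrite hl'.
    (* The added nodes [t - K] and [t + K] need not be nodes of [l]; the nonstrict principle bounds
       the combination there too. *)
    pose proof (hmp l M (snd q) ltac:(lra) hl).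
    apply (in_map snd) in hq. rewrite hmap in hq. specialize (H _ hq). nra. }
  rewrite hl' in h. nra.
Qed.

(** The translate at [t] has value 1 at [t] but stays below a constant less than 1 on finitely many
    other points, which the maximum principle forbids for a combination with those nodes. *)
Lemma kernel_translate_independent (g : R -> R) (l : list (R * R)) (t : R) :
  decaying_profile g -> ~ In t (map snd l) ->
  ~ (forall s, g (Rabs (s - t)) = comb (fun s t => g (Rabs (s - t))) l s).
Proof.
  intros hg ht h. assert (hg' := hg). destruct hg' as [htm [hc [h0 _]]].
  destruct (finite_gap (fun x => - g (Rabs (x - t))) (-1) (map snd l)) as [b [hb H]].
  { intros x hx. assert (hx' : 0 < Rabs (x - t)).
    { apply Rabs_pos_lt. intros e. apply ht. replace t with x by lra. exact hx. }
    pose proof (profile_lt_1 g _ hg hx'). lra. }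
  pose proof (kernel_max_principle g htm hc l (Rmax 0 (- b)) t (Rmax_l _ _)) as hm.
  cbv beta in hm. rewrite <- h, Rminus_diag, Rabs_R0, h0 in hm.
  assert (1 <= Rmax 0 (- b)).
  { apply hm. intros q hq. rewrite <- h.
    eapply Rle_trans; [|apply Rmax_r]. specialize (H _ (in_map snd _ _ hq)). lra. }
  unfold Rmax in *. destruct (Rle_dec 0 (- b)); lra.
Qed.

(** * From CMF dictionaries to correlations and OMP traces *)

Lemma CMF_dictionary_profile {H : RHilbert} (a : R -> H) : CMF_dictionary a ->
  exists g, decaying_profile g /\ forall s t, hinner (a s) (a t) = g (Rabs (s - t)).
Proof.
  intros [phi [p [hphi [h0 [hlim [hp ha]]]]]].
  exists (fun t => phi (rpow t p)). split; [|exact ha].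
  split; [apply CMF_power_totally_monotone; assumption|].
  split; [apply CMF_power_right_continuous; [assumption|assumption|lra]|].
  split.
  - unfold rpow. destruct (Req_EM_T 0 0); [exact h0|lra].
  - intros e he. destruct (hlim e he) as [M hM].
    (* Beyond [M] and positive, so that the point [x^(1/p)] has [p]-th power [x]. *)
    set (x := Rmax M 1 + 1). pose proof (Rmax_l M 1). pose proof (Rmax_r M 1).
    exists (Rpower x (/ p)). split; [apply exp_pos|].
    assert (hx : rpow (Rpower x (/ p)) p = x).
    { unfold rpow. destruct (Req_EM_T (Rpower x (/ p)) 0) as [hz|_].
      - pose proof (exp_pos (/ p * ln x)). unfold Rpower in hz. lra.
      - rewrite Rpower_mult, Rinv_l, Rpower_1; [reflexivity|unfold x; lra|lra]. }
    rewrite hx. specialize (hM x ltac:(unfold x; lra)). apply Rabs_def2 in hM. lra.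
Qed.

Lemma hinner_zero_l {H : RHilbert} (v : H) : hinner hzero v = 0.
Proof.
  pose proof (hinner_add_l _ (@hzero H) hzero v) as h. rewrite hadd_zero in h. lra.
Qed.

Lemma hinner_zero_r {H : RHilbert} (v : H) : hinner v hzero = 0.
Proof. rewrite hinner_sym. apply hinner_zero_l. Qed.

Lemma hinner_add_r {H : RHilbert} (u v w : H) :
  hinner u (hadd v w) = hinner u v + hinner u w.
Proof. rewrite hinner_sym, hinner_add_l, !(hinner_sym _ u). reflexivity. Qed.

Lemma hinner_sub_r {H : RHilbert} (u v w : H) :
  hinner u (hsub v w) = hinner u v - hinner u w.
Proof.
  unfold hsub. rewrite hinner_add_r.
  pose proof (hinner_add_r u w (hopp w)) as h. rewrite hadd_opp, hinner_zero_r in h. lra.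
Qed.

Lemma hinner_lincomb {H : RHilbert} (a : R -> H) (v : H) (cs ths : list R) :
  hinner v (lincomb a cs ths)
    = Rsum (fun q => fst q * hinner v (a (snd q))) (combine cs ths).
Proof.
  revert ths. induction cs as [|c cs IH]; intros [|th ths]; try apply hinner_zero_r.
  cbn [lincomb combine]. rewrite hinner_add_r, Rsum_cons, IH.
  rewrite hinner_sym, hinner_scal_l, (hinner_sym _ _ v). reflexivity.
Qed.

(* [r] is the combination of atoms described by [l], expressed through inner products. *)
Definition expands {H : RHilbert} (a : R -> H) (l : list (R * R)) (r : H) : Prop :=
  forall v, hinner v r = Rsum (fun q => fst q * hinner v (a (snd q))) l.

Definition neg_coefs (l : list (R * R)) : list (R * R) :=
  map (fun q => (- fst q, snd q)) l.

Lemma Rsum_neg_coefs (F : R -> R) (l : list (R * R)) :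
  Rsum (fun q => fst q * F (snd q)) (neg_coefs l) = - Rsum (fun q => fst q * F (snd q)) l.
Proof.
  unfold neg_coefs. rewrite Rsum_map. simpl.
  rewrite (Rsum_ext _ (fun q => (-1) * (fst q * F (snd q)))) by (intros; ring).
  rewrite Rsum_scal. ring.
Qed.

Lemma map_snd_neg_coefs (l : list (R * R)) : map snd (neg_coefs l) = map snd l.
Proof. unfold neg_coefs. rewrite map_map. reflexivity. Qed.

(** The strict maximum principle, applied to the correlation and to its negative with bound the
    maximal modulus, excludes a maximizer off the nodes. *)
Lemma argmax_in_support {H : RHilbert} (a : R -> H) (g : R -> R) (l : list (R * R))
    (r : H) (th : R) :
  decaying_profile g -> (forall s t, hinner (a s) (a t) = g (Rabs (s - t))) ->
  expands a l r -> r <> hzero -> is_argmax_corr a r th -> In th (map snd l).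
Proof.
  intros hg ha hr hne hmax. apply NNPP. intros hth.
  set (k := fun s t => g (Rabs (s - t))).
  assert (hcorr : forall t, hinner (a t) r = comb k l t).
  { intros t. rewrite hr. unfold comb. apply Rsum_ext. intros q _. rewrite ha. reflexivity. }
  (* If the maximal correlation were 0, [r] would be orthogonal to the atoms it is made of, hence to
     itself. *)
  assert (hpos : 0 < Rabs (comb k l th)).
  { destruct (Rabs_pos (comb k l th)) as [|hz]; [assumption|exfalso].
    apply hne, hinner_def. rewrite hr. rewrite (Rsum_ext _ (fun _ => 0)); [apply Rsum_zero|].
    intros q _. specialize (hmax (snd q)). rewrite !hcorr, <- hz in hmax.
    rewrite hinner_sym, hcorr.
    pose proof (Rabs_pos (comb k l (snd q))) as h1.
    assert (h2 : Rabs (comb k l (snd q)) = 0) by lra.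
    destruct (Req_dec (comb k l (snd q)) 0) as [->|h3]; [ring|].
    apply Rabs_no_R0 in h3. contradiction. }
  assert (hb : forall t, Rabs (comb k l t) <= Rabs (comb k l th)).
  { intros t. rewrite <- !hcorr. apply hmax. }
  assert (h1 : comb k l th < Rabs (comb k l th)).
  { apply strict_max_principle; auto. intros q _.
    eapply Rle_trans; [apply Rle_abs|apply hb]. }
  assert (hneg : forall t, comb k (neg_coefs l) t = - comb k l t).
  { intros t. apply (Rsum_neg_coefs (fun x => k t x)). }
  assert (h2 : comb k (neg_coefs l) th < Rabs (comb k l th)).
  { apply strict_max_principle; auto.
    - rewrite map_snd_neg_coefs. exact hth.
    - intros q _. fold k. rewrite hneg, <- (Rabs_Ropp (comb k l th)).
      eapply Rle_trans; [apply Rle_abs|]. rewrite !Rabs_Ropp. apply hb. }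
  rewrite hneg in h2. unfold Rabs in *. destruct (Rcase_abs (comb k l th)); lra.
Qed.

Lemma map_snd_combine_incl {A B : Type} (l : list A) (l' : list B) :
  incl (map snd (combine l l')) l'.
Proof.
  intros x hx. apply in_map_iff in hx. destruct hx as [[u v] [<- h]].
  apply in_combine_r in h. exact h.
Qed.

Lemma map_snd_combine {A B : Type} (l : list A) : forall l' : list B,
  length l = length l' -> map snd (combine l l') = l'.
Proof.
  induction l as [|x l IH]; intros [|y l'] h; simpl in *; try discriminate; auto.
  f_equal. apply IH. congruence.
Qed.

Lemma expands_residual {H : RHilbert} (a : R -> H) (cs ths cs' ths' : list R) :
  expands a (combine cs ths ++ neg_coefs (combine cs' ths'))
    (hsub (lincomb a cs ths) (lincomb a cs' ths')).
Proof.
  intros v. rewrite hinner_sub_r, !hinner_lincomb, Rsum_app.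
  rewrite (Rsum_neg_coefs (fun x => hinner v (a x))). ring.
Qed.

(** Both claims are carried together: a residual expanded over [S] selects an atom of [S], and
    selections within [S] keep the next residual expanded over [S]. *)
Lemma omp_trace_in_support {H : RHilbert} (a : R -> H) (g : R -> R) (cs S sel : list R) (r : H) :
  decaying_profile g -> (forall s t, hinner (a s) (a t) = g (Rabs (s - t))) ->
  omp_trace a (lincomb a cs S) sel r ->
  incl sel S /\ exists l, incl (map snd l) S /\ expands a l r.
Proof.
  intros hg ha htr. induction htr as [|sel r th r' htr [IHs [l [IHl hr]]] hne hmax hls].
  - split; [intros x []|]. exists (combine cs S). split; [apply map_snd_combine_incl|].
    intros v. apply hinner_lincomb.
  - assert (hsel : incl (sel ++ [th]) S).
    { apply incl_app; [assumption|]. intros x [<-|[]].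
      apply IHl. eapply argmax_in_support; eassumption. }
    split; [assumption|]. destruct hls as [cs' [_ [-> _]]].
    eexists. split; [|apply expands_residual].
    rewrite map_app, map_snd_neg_coefs. apply incl_app; [apply map_snd_combine_incl|].
    eapply incl_tran; [apply map_snd_combine_incl|exact hsel].
Qed.

Lemma omp_trace_residual {H : RHilbert} (a : R -> H) (y : H) (sel : list R) (r : H) :
  omp_trace a y sel r -> exists cs, r = hsub y (lincomb a cs sel).
Proof.
  intros h. destruct h as [|sel r th r' _ _ _ [cs [_ [e _]]]].
  - exists []. unfold hsub. simpl.
    assert (e : hadd hzero (hopp hzero) = hopp (@hzero H)) by (rewrite hadd_comm; apply hadd_zero).
    rewrite hadd_opp in e. rewrite <- e, hadd_zero. reflexivity.
  - exists cs. exact e.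
Qed.

(** A zero residual is a linear relation between atoms. An unselected [th] of [S] would occur in it
    once, with nonzero coefficient, and could be solved for, against independence. *)
Lemma support_in_selection {H : RHilbert} (a : R -> H) (g : R -> R) (cs S cs' sel : list R) :
  decaying_profile g -> (forall s t, hinner (a s) (a t) = g (Rabs (s - t))) ->
  NoDup S -> length cs = length S -> Forall (fun c => c <> 0) cs ->
  hsub (lincomb a cs S) (lincomb a cs' sel) = hzero -> incl S sel.
Proof.
  intros hg ha hnd hlen hcs hz th hth. apply NNPP. intros hno.
  assert (hms := map_snd_combine cs S hlen).
  assert (hin : In th (map snd (combine cs S))) by (rewrite hms; exact hth).
  apply in_map_iff in hin. destruct hin as [[c x] [hx hin]]. simpl in hx. subst x.
  assert (hc : c <> 0).
  { apply (proj1 (Forall_forall _ _) hcs). apply in_combine_l in hin. exact hin. }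
  pose proof (expands_residual a cs S cs' sel) as hexp. rewrite hz in hexp.
  apply in_split in hin. destruct hin as [l1 [l2 hsp]].
  rewrite hsp in hexp. rewrite <- hms, hsp, map_app in hnd. simpl in hnd.
  (* Distinctness of the parameters ensures that no other term of the original signal sits at
     [th]. *)
  apply NoDup_remove_2 in hnd.
  set (l := l1 ++ l2 ++ neg_coefs (combine cs' sel)).
  apply (kernel_translate_independent g (map (fun q => (- fst q / c, snd q)) l) th hg).
  - rewrite map_map. simpl. unfold l. rewrite !map_app, map_snd_neg_coefs.
    intros h. rewrite app_assoc in h. apply in_app_or in h. destruct h as [h|h]; [contradiction|].
    apply hno. apply (map_snd_combine_incl cs' sel), h.
  - intros s. specialize (hexp (a s)).
    rewrite hinner_zero_r, Rsum_app, Rsum_app, Rsum_cons in hexp. cbn [fst snd] in hexp.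
    rewrite ha in hexp.
    unfold comb. rewrite Rsum_map. cbn [fst snd].
    rewrite (Rsum_ext _ (fun q => (- / c) * (fst q * hinner (a s) (a (snd q)))))
      by (intros; rewrite ha; field; assumption).
    rewrite Rsum_scal. unfold l. rewrite !Rsum_app.
    apply Rmult_eq_reg_l with c; [|assumption].
    rewrite <- Rmult_assoc. replace (c * - / c) with (-1) by (field; assumption). lra.
Qed.

Theorem theorem3 (H : RHilbert) (a : R -> H) :
  CMF_dictionary a ->
  forall Sstar : list R, NoDup Sstar -> exact_recovery a Sstar.
Proof.
  intros ha Sstar hnd cs hlen hcs S [sel [htr hS]] th.
  destruct (CMF_dictionary_profile a ha) as [g [hg hag]].
  rewrite hS. split.
  - apply (proj1 (omp_trace_in_support a g cs Sstar sel hzero hg hag htr)).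
  - destruct (omp_trace_residual a _ _ _ htr) as [cs' e].
    apply (support_in_selection a g cs Sstar cs' sel); auto.
Qed.
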